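(* Let $$P(x,t)=\sum_{\substack{\omega\in\mathrm{Cay}_+\\ \omega\text{ primitive}}}x^{|\omega|}t^{\mu(\omega)},\qquad \widehat S_{\geq3}(x,y)=\sum_{\substack{\sigma\text{ primitive simple}\\|\sigma|\geq3}}x^{|\sigma|-\mu(\sigma)}y^{\mu(\sigma)},$$ where the second sum is over Cayley permutations $\sigma$ of length at least three that are both primitive and simple. Then $$\widehat S_{\geq3}\bigl(x,P(x,t)\bigr)=P(x,t)-tx-\frac{2P(x,t)^2}{1+P(x,t)}.$$ Let $W(x)$ be the unique formal power series with $P\bigl(x,W(x)\bigr)=x$. Then the ordinary generating function $\widehat S(x)=\sum_{n\geq1}\hat s_nx^n$, where $\hat s_n$ is the number of primitive simple Cayley permutations of length $n$, is $$\widehat S(x)=2x+\frac{2x^3}{1+x}-xW(x).$$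
   Context: Write $[n]=\{1,\ldots,n\}$. A Cayley permutation of length $n$ is a word $\omega=w_1\cdots w_n$ of positive integers whose set of letters is $[m]$ for some $m\leq n$; equivalently a map $\omega:[n]\to[n]$, $\omega(i)=w_i$, with image $[m]$. $\mathrm{Cay}_n$ is the set of those of length $n$, $\mathrm{Cay}_+=\bigcup_{n\geq1}\mathrm{Cay}_n$, and $|\omega|$ denotes length. $\mu(\omega)=\#\{j:|\omega^{-1}(j)|=1\}$ is the number of values occurring exactly once in $\omega$. A nonempty interval of positions $I=[a,b]\subseteq[n]$ is an H-interval of $\omega\in\mathrm{Cay}_n$ if there is an interval of values $J=[c,d]$ with $\omega(I)=J$ and $\omega^{-1}(J)=I$. $\omega\in\mathrm{Cay}_n$ is simple if every H-interval of $\omega$ is a singleton or equals $[n]$. $\omega$ is primitive if it has no two equal adjacent letters. The series $P$ has the form $tx+\sum_{k\geq2}P_k(t)x^k$ with $P_k(t)\in\mathbb{Z}[t]$, and there is exactly one formal power series $W(x)\in\mathbb{Z}[[x]]$ with $P(x,W(x))=x$. *)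

(* Defs.v *)
From HB Require Import structures.
From mathcomp Require Import all_boot all_order all_algebra.
From mathcomp Require Import zify.
From mathcomp Require Import boolp.

Set Implicit Arguments.
Unset Strict Implicit.
Unset Printing Implicit Defensive.
Import GRing.Theory.
Local Open Scope ring_scope.

(* R[[X]]: the series f stands for \sum_n (f n) X^n. *)
Record fps (R : Type) := Fps { fps_coef :> nat -> R }.

Lemma fpsP (R : Type) (f g : fps R) : (forall n, f n = g n) -> f = g.
Proof. by case: f g => [f] [g] /= /funext ->. Qed.

HB.instance Definition _ (R : Type) := gen_eqMixin (fps R).
HB.instance Definition _ (R : Type) := gen_choiceMixin (fps R).

Section Ring.
Variable R : comNzRingType.
Implicit Types f g h : fps R.

Definition fps_const (c : R) : fps R := Fps (fun n => if n == 0%N then c else 0).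
Definition fps_X : fps R := Fps (fun n => (n == 1%N)%:R).

Definition fps_add f g := Fps (fun n => f n + g n).
Definition fps_opp f := Fps (fun n => - f n).
Definition fps_mul f g := Fps (fun n => \sum_(i < n.+1) f i * g (n - i)%N).

Fact fps_addA : associative fps_add.
Proof. by move=> f g h; apply: fpsP => n /=; rewrite addrA. Qed.
Fact fps_addC : commutative fps_add.
Proof. by move=> f g; apply: fpsP => n /=; rewrite addrC. Qed.
Fact fps_add0 : left_id (fps_const 0) fps_add.
Proof. by move=> f; apply: fpsP => n /=; rewrite if_same add0r. Qed.
Fact fps_addN : left_inverse (fps_const 0) fps_opp fps_add.
Proof. by move=> f; apply: fpsP => n /=; rewrite if_same addNr. Qed.

HB.instance Definition _ :=
  GRing.isZmodule.Build (fps R) fps_addA fps_addC fps_add0 fps_addN.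

Definition fps_trunc N f : {poly R} := \poly_(i < N) f i.

Fact coef_fps_mul N f g n : (n < N)%N ->
  fps_mul f g n = (fps_trunc N f * fps_trunc N g)`_n.
Proof.
move=> ltnN; rewrite coefM /=; apply: eq_bigr => i _.
rewrite !coef_poly (leq_ltn_trans (leq_subr _ _) ltnN).
by rewrite (leq_trans (ltn_ord i)).
Qed.

Fact fps_mulC : commutative fps_mul.
Proof.
by move=> f g; apply: fpsP => n; rewrite !(coef_fps_mul _ _ (ltnSn n)) mulrC.
Qed.

Fact fps_mulA : associative fps_mul.
Proof.
move=> f g h; apply: fpsP => n.
pose t := fps_trunc n.+1.
transitivity ((t f * (t g * t h))`_n).
  rewrite coefM /=; apply: eq_bigr => i _.
  rewrite {1}/t coef_poly ltn_ord; congr (_ * _).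
  by apply: coef_fps_mul; rewrite ltnS leq_subr.
rewrite mulrA coefM /=; apply: eq_bigr => i _.
rewrite {3}/t coef_poly ltnS leq_subr; congr (_ * _).
by apply/esym; apply: coef_fps_mul.
Qed.

Fact fps_mul1 : left_id (fps_const 1) fps_mul.
Proof.
move=> f; apply: fpsP => n /=.
rewrite big_ord_recl /= mul1r subn0 big1 ?addr0 // => i _.
by rewrite mul0r.
Qed.

Fact fps_mulDl : left_distributive fps_mul fps_add.
Proof.
move=> f g h; apply: fpsP => n /=; rewrite -big_split /=.
by apply: eq_bigr => i _; rewrite mulrDl.
Qed.

Fact fps_one_neq0 : fps_const 1 != 0.
Proof.
apply/eqP => /(congr1 (fun f : fps R => f 0%N)) /= /eqP.
by rewrite oner_eq0.
Qed.

HB.instance Definition _ :=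
  GRing.Zmodule_isComNzRing.Build (fps R)
    fps_mulA fps_mulC fps_mul1 fps_mulDl fps_one_neq0.

Lemma fpsD f g n : (f + g) n = f n + g n. Proof. by []. Qed.
Lemma fpsN f n : (- f) n = - f n. Proof. by []. Qed.
Lemma fps0 n : (0 : fps R) n = 0. Proof. exact: if_same. Qed.
Lemma fps1 n : (1 : fps R) n = (n == 0%N)%:R. Proof. by case: n. Qed.
Lemma fpsM f g n : (f * g) n = \sum_(i < n.+1) f i * g (n - i)%N.
Proof. by []. Qed.

Lemma fps_sum I (r : seq I) (P : pred I) (F : I -> fps R) n :
  (\sum_(i <- r | P i) F i) n = \sum_(i <- r | P i) F i n.
Proof.
exact: (big_morph (fun f : fps R => f n) (fun f g => fpsD f g n) (fps0 n)).
Qed.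

Lemma fpsX_lt f k n : f 0%N = 0 -> (n < k)%N -> (f ^+ k) n = 0.
Proof.
move=> f0; elim: k n => // k IHk n lt_nk; rewrite exprS fpsM big1 // => i _.
case: i => [[|i] lt_in] /=; first by rewrite f0 mul0r.
by rewrite IHk ?mulr0 //; lia.
Qed.

End Ring.

Arguments fps_X {R}.

Section UnitRing.
Variable R : comUnitRingType.
Implicit Types f g h : fps R.

Definition fps_unit : {pred fps R} := [pred f : fps R | f 0%N \is a GRing.unit].

(* With h := 1 - f / f 0 one has 1 / f = (1 / f 0) \sum_k h ^ k, where h ^ k
   only contributes to the coefficients of index at least k. *)
Definition fps_inv f : fps R :=
  if f \in fps_unit then
    Fps (fun n => (f 0%N)^-1 *
      (\sum_(k < n.+1) (1 - fps_const (f 0%N)^-1 * f) ^+ k) n)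
  else f.

Fact fps_constM (c : R) f n : (fps_const c * f) n = c * f n.
Proof.
rewrite fpsM big_ord_recl /= subn0 big1 ?addr0 // => i _.
by rewrite mul0r.
Qed.

Fact fps_mulV : {in fps_unit, left_inverse 1 fps_inv *%R}.
Proof.
move=> f uf; rewrite /fps_inv uf; rewrite inE in uf.
set c := (f 0%N)^-1; set h := 1 - fps_const c * f.
have h0 : h 0%N = 0 by rewrite /h fpsD fpsN fps_constM fps1 mulVr ?subrr.
pose G : fps R := Fps (fun n => (\sum_(k < n.+1) h ^+ k) n).
have -> : Fps (fun n => c * (\sum_(k < n.+1) h ^+ k) n) = fps_const c * G.
  by apply: fpsP => n; rewrite fps_constM.
have -> : fps_const c * G * f = (1 - h) * G.
  by rewrite /h subKr mulrAC.
apply: fpsP => n.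
have GE m : (m <= n)%N -> G m = (\sum_(k < n.+1) h ^+ k) m.
  move=> le_mn; rewrite /G /= !fps_sum -!(big_mkord xpredT (fun k => (h ^+ k) m)).
  rewrite [RHS](big_cat_nat (n := m.+1)) //= [X in _ + X]big_nat_cond.
  rewrite [X in _ + X]big1 ?addr0 // => k /andP[/andP[lt_mk _] _].
  exact: fpsX_lt.
have -> : ((1 - h) * G) n = ((1 - h) * \sum_(k < n.+1) h ^+ k) n.
  by rewrite !fpsM; apply: eq_bigr => i _; rewrite GE ?leq_subr.
have -> : (1 - h) * \sum_(k < n.+1) h ^+ k = 1 - h ^+ n.+1.
  by rewrite -opprB mulNr -subrX1 opprB.
by rewrite fpsD fpsN fpsX_lt // subr0.
Qed.

Fact fps_unitPl f g : g * f = 1 -> fps_unit f.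
Proof.
move=> /(congr1 (fun f : fps R => f 0%N)).
rewrite fpsM big_ord1 subnn fps1 /= => gf1.
by apply/unitrPr; exists (g 0%N); rewrite mulrC.
Qed.

Fact fps_inv_out : {in [predC fps_unit], fps_inv =1 id}.
Proof. by move=> f; rewrite inE /= /fps_inv => /negPf ->. Qed.

HB.instance Definition _ :=
  GRing.ComNzRing_hasMulInverse.Build (fps R) fps_mulV fps_unitPl fps_inv_out.

End UnitRing.

(* \sum_k (F k) X^k for an arbitrary sequence F of series. *)
Definition fps_sumX (R : comNzRingType) (F : nat -> fps R) : fps R :=
  Fps (fun n => \sum_(k < n.+1) F k (n - k)%N).

(* f(g) = \sum_j (f j) g^j; meaningful only when g has no constant term, in
   which case g^j does not contribute to the coefficients of index below j. *)
Definition fps_comp (R : comNzRingType) (f : fps int) (g : fps R) : fps R :=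
  Fps (fun n => \sum_(j < n.+1) (g ^+ j) n *~ f j).

(* A bivariate series S(x, y) is an element of Z[[y]][[x]]; this is
   S(x, Q(x)), for Q without constant term. *)
Definition subst_y (R : comNzRingType) (S : fps (fps int)) (Q : fps R) : fps R :=
  fps_sumX (fun i => fps_comp (S i) Q).

(* F(x, W(x)) for F(x, t) in Z[t][[x]]: here W may have a constant term. *)
Definition subst_t (F : fps {poly int}) (W : fps int) : fps int :=
  fps_sumX (fun k => (map_poly intr (F k)).[W]).

(* Positions and values are numbered from 0: 'I_n stands for [n]. *)
Section Cayley.
Variable n : nat.
Implicit Types (w : {ffun 'I_n -> 'I_n}) (I J : {set 'I_n}).

Definition cayley w : bool :=
  [exists m : 'I_n.+1, w @: setT == [set j : 'I_n | (j < m)%N]].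

Definition mu w : nat := #|[set j : 'I_n | #|w @^-1: [set j]| == 1%N]|.

Definition primitive w : bool :=
  [forall i : 'I_n, forall j : 'I_n, (j == i.+1 :> nat) ==> (w i != w j)].

Definition is_itv I : bool :=
  [exists a : 'I_n, exists b : 'I_n,
     (a <= b)%N && (I == [set i : 'I_n | (a <= i <= b)%N])].

Definition H_interval w I : bool :=
  is_itv I &&
  [exists J : {set 'I_n}, [&& is_itv J, w @: I == J & w @^-1: J == I]].

Definition simple w : bool :=
  [forall I : {set 'I_n}, H_interval w I ==> (#|I| == 1%N) || (I == setT)].

End Cayley.

(* P(x, t); the empty word is excluded. *)
Definition P : fps {poly int} :=
  Fps (fun n => \sum_(w : {ffun 'I_n -> 'I_n} |
                      [&& (0 < n)%N, cayley w & primitive w]) 'X^(mu w)).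

(* The coefficient of x^i y^j counts the words s with |s| - mu s = i and
   mu s = j, that is, |s| = i + j and mu s = j. *)
Definition Shat_ge3 : fps (fps int) :=
  Fps (fun i => Fps (fun j =>
    #|[set w : {ffun 'I_(i + j) -> 'I_(i + j)} |
        [&& (3 <= i + j)%N, cayley w, primitive w, simple w & mu w == j]]|%:Z)).

Definition Shat : fps int :=
  Fps (fun n =>
    #|[set w : {ffun 'I_n -> 'I_n} |
        [&& (0 < n)%N, cayley w, primitive w & simple w]]|%:Z).

(* Main.v *)
From HB Require Import structures.
Require Import Defs.
From mathcomp Require Import all_boot all_order all_algebra.
From mathcomp Require Import zify ring.
From mathcomp Require Import boolp.

(* Two words are order isomorphic if their positions compare in the same way.
   A Cayley permutation is the least word of its class, so all arguments can be
   made with comparisons of positions only. Call a word decomposable if it is a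
   direct or a skew sum; a decomposable word of either kind has a unique first
   indecomposable summand, so each kind has generating function D with
   D (1 + P) = P^2. If w is not decomposable, the union of two overlapping
   proper H-intervals is again a proper H-interval, so the maximal ones are
   disjoint, and contracting them gives a primitive simple word of length at
   least 3, in which only values occurring once are inflated. Conversely, in an
   inflation of such a simple word the proper H-intervals are contained in the
   inflated letters, so the decomposition is unique. This gives the first
   identity. Substituting t := W(x) into it, where P(x, W(x)) = x is solved by
   iterating a contraction of Z[[x]], gives the second one. *)

Set Implicit Arguments.
Unset Strict Implicit.
Unset Printing Implicit Defensive.

Local Notation "w `@ i" := (nth 0%N w i)
  (at level 2, i at level 1, left associativity, format "w `@ i").

Implicit Types (w s u v sh : seq nat) (bs : seq (seq nat)) (A B : pred nat).

(** * Words up to order isomorphism *)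

(** An H-interval requires both an interval of values and the full preimage of that interval, so a
    contracted block leaves a letter that occurs once. A repeated letter of the simple word
    therefore stands for one position. This is why it is marked by [x] while a letter occurring once
    is replaced by [P], and why [x] has exponent $|\sigma|-\mu(\sigma)$. Sums need separate
    treatment because maximal blocks fail to be disjoint there: in 123 the proper blocks 12 and 23
    overlap and cover the word. The only quotients of length two are 12 and 21, since primitivity
    rules out 11. From length three on, a simple word can be recovered from its inflation. Inflation
    changes both length and values, so equalities between words are awkward. It is specified by
    comparisons of positions instead, and equality of words is recovered only at the end, for Cayley
    words, by [cay_pat_inj]. The variable [t] makes the first identity solvable for the simple
    words: [P] starts with [t x], so [t] can be chosen as a series in [x] that turns [P] into [x],
    and [x] and [y] then mark positions alike. *)

Definition cay w : bool := all (fun x => all (mem w) (iota 0 x)) w.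

Definition uniqv w x : bool := count_mem x w == 1.

Definition nuniq w : nat := count (uniqv w) w.

Definition prim w : bool := sorted (fun x y => x != y) w.

(** Strict comparisons suffice: two letters are equal when neither is below the other ([nth_eqlt]),
    so repetitions are preserved too. *)
Definition pat u v : Prop :=
  size u = size v /\
  forall i j, i < size u -> j < size u -> (u`@i < u`@j) = (v`@i < v`@j).

Lemma cayP w :
  reflect (forall x y, y \in w -> x < y -> x \in w) (cay w).
Proof.
apply: (iffP allP) => [cw x y /cw /allP cy ltxy | cw y wy].
  by apply: cy; rewrite mem_iota.
by apply/allP => x; rewrite mem_iota => ltxy; apply: (cw x y).
Qed.

Lemma cay_lt w x : cay w -> x \in w -> x < size w.
Proof.
move=> /cayP cw wx; rewrite -(size_iota 0 x.+1).
apply: uniq_leq_size (iota_uniq _ _) _ => y; rewrite mem_iota add0n ltnS /= leq_eqVlt.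
by case/orP => [/eqP->//|]; apply: cw.
Qed.

Lemma primP w :
  reflect (forall i, i.+1 < size w -> w`@i != w`@i.+1) (prim w).
Proof. exact: sortedP. Qed.

Lemma nth_eqlt u i j : (u`@i == u`@j) = ~~ (u`@i < u`@j) && ~~ (u`@j < u`@i).
Proof. by rewrite -!leqNgt eqn_leq andbC. Qed.

Lemma pat_sym u v : pat u v -> pat v u.
Proof. by case=> e h; split=> // i j; rewrite -e => iu ju; rewrite h. Qed.

Lemma pat_eq u v i j : pat u v -> i < size u -> j < size u ->
  (u`@i == u`@j) = (v`@i == v`@j).
Proof. by case=> _ h iu ju; rewrite !nth_eqlt !h. Qed.

(** Induction on the letter: below a letter [a.+1] of [u] the letter [a] also occurs, at some [j];
    then [v] is at least [a] at [j] and strictly larger at [i]. *)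
Lemma pat_cay_le u v : cay u -> pat u v -> forall i, i < size u -> u`@i <= v`@i.
Proof.
move=> /cayP cu [euv h] i; have [m] := ubnP (u`@i).
elim: m i => // m IH i lt_m iu.
case E: (u`@i) => [//|a].
have: a \in u by apply: (cu a u`@i); rewrite ?mem_nth ?E.
case/(nthP 0) => j ju uja.
have := h j i ju iu; rewrite uja E ltnSn => /esym lt_v.
by apply: leq_ltn_trans lt_v; rewrite -[a]uja; apply: IH; rewrite ?uja -?E.
Qed.

Lemma cay_pat_inj u v : cay u -> cay v -> pat u v -> u = v.
Proof.
move=> cu cv puv; have [e _] := puv; apply: (@eq_from_nth _ 0) => // i iu.
apply/eqP; rewrite eqn_leq (pat_cay_le cu puv) //.
by rewrite (pat_cay_le cv (pat_sym puv)) -?e.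
Qed.

(** The count runs over values, not positions, so it is the number of distinct letters of [w] below
    [x]; ranking removes the gaps between letters. *)
Definition rank w x := count (mem w) (iota 0 x).
Definition std w := map (rank w) w.

Lemma rankS w x : rank w x.+1 = rank w x + (x \in w).
Proof. by rewrite /rank -addn1 iotaD count_cat /= add0n addn0. Qed.

Lemma leq_rank w x y : x <= y -> rank w x <= rank w y.
Proof.
by move=> lexy; rewrite /rank -(subnKC lexy) iotaD count_cat leq_addr.
Qed.

Lemma ltn_rank w x y : x \in w -> (rank w x < rank w y) = (x < y).
Proof.
move=> wx; case: (ltnP x y) => [ltxy|leyx].
  by apply: leq_trans (leq_rank w ltxy); rewrite rankS wx addn1.
by rewrite ltnNge leq_rank.
Qed.

Lemma size_std w : size (std w) = size w.
Proof. exact: size_map. Qed.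

Lemma std_pat w : pat (std w) w.
Proof.
split=> [|i j]; rewrite size_std // => iw jw.
by rewrite !(nth_map 0) // ltn_rank ?mem_nth.
Qed.

Lemma std_cay w : cay (std w).
Proof.
apply/cayP => m _ /mapP[y wy ->].
elim: y {wy} => // y IH; rewrite rankS.
case wy: (y \in w); last by rewrite addn0.
rewrite addn1 ltnS leq_eqVlt => /orP[/eqP->|//].
by apply/mapP; exists y.
Qed.

Lemma uniqv_nthP w i : i < size w ->
  reflect (forall j, j < size w -> w`@j = w`@i -> j = i) (uniqv w w`@i).
Proof.
move=> iw; have h0 : 0 < count_mem w`@i w by rewrite -has_count has_pred1 mem_nth.
rewrite /uniqv; apply: (iffP eqP) => [e j jw ji | h].
- wlog lt_ij: i j iw jw ji {h0} e / i < j.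
    move=> W; case: (ltngtP i j) => // [/W -> //|/W <- //].
    by rewrite ji.
  move: e; rewrite -[X in count _ X](cat_take_drop j w) count_cat (drop_nth 0) //= ji eqxx.
  rewrite addnCA => e; have: 0 < count_mem w`@i (take j w).
    rewrite -has_count has_pred1; rewrite -[X in X \in _](@nth_take j) //.
    by rewrite mem_nth // size_take jw.
  by case: (count _ _) e.
- rewrite -[X in count _ X](cat_take_drop i w) count_cat (drop_nth 0) //= eqxx.
  have -> : count_mem w`@i (take i w) = 0.
    apply/eqP; rewrite -leqn0 leqNgt -has_count has_pred1; apply/negP.
    case/(nthP 0) => j; rewrite size_take iw => ji; rewrite nth_take // => e.
    by have := h j (ltn_trans ji iw) e; lia.
  have -> : count_mem w`@i (drop i.+1 w) = 0; last by [].
    apply/eqP; rewrite -leqn0 leqNgt -has_count has_pred1; apply/negP.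
    case/(nthP 0) => j; rewrite size_drop ltn_subRL => ji; rewrite nth_drop => e.
    by have := h _ ji e; lia.
Qed.

Lemma pat_uniqv u v i : pat u v -> i < size u ->
  uniqv u u`@i = uniqv v v`@i.
Proof.
move=> puv iu; have [e _] := puv; have iv : i < size v by rewrite -e.
apply/(uniqv_nthP iu)/(uniqv_nthP iv) => h j.
  by rewrite -e => ju /eqP; rewrite -(pat_eq puv) // => /eqP; apply: h.
by move=> ju /eqP; rewrite (pat_eq puv) // => /eqP; apply: h; rewrite -e.
Qed.

Lemma count_nth (a : pred nat) w : count a w = count (fun i => a w`@i) (iota 0 (size w)).
Proof. by rewrite -[in LHS](mkseq_nth 0 w) /mkseq count_map. Qed.

(** * Cutting positions into chunks *)

Lemma reshape_index_cons a sh i :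
  reshape_index (a :: sh) i = if i < a then 0 else (reshape_index sh (i - a)).+1.
Proof.
by rewrite /reshape_index /= subn_eq0; case: ltnP => // le_ai; rewrite subSn.
Qed.

Lemma leq_reshape_index sh i j :
  i <= j -> reshape_index sh i <= reshape_index sh j.
Proof. by rewrite (reshape_leq sh); case/orP => [/ltnW//|/andP[/eqP->]]. Qed.

Lemma reshape_start sh r : 0 \notin sh -> r < size sh ->
  flatten_index sh r 0 < sumn sh /\ reshape_index sh (flatten_index sh r 0) = r.
Proof.
move=> sh0 r_sh; have sh_r : 0 < sh`@r.
  by rewrite lt0n; apply: contraNneq sh0 => <-; rewrite mem_nth.
by split; [apply: flatten_indexP | apply: flatten_indexKl].
Qed.

Lemma reshape_indexS sh i : 0 \notin sh -> i.+1 < sumn sh ->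
  reshape_index sh i.+1 <= (reshape_index sh i).+1.
Proof.
move=> sh0 ish; rewrite leqNgt; apply/negP => lt_ri.
have ri1 : (reshape_index sh i).+1 < size sh.
  exact: ltn_trans lt_ri (reshape_indexP ish).
have [_] := reshape_start sh0 ri1; move: (flatten_index _ _ _) => j rj.
have : i < j by rewrite ltnNge; apply/negP => /(leq_reshape_index sh); rewrite rj ltnn.
by move/(leq_reshape_index sh); rewrite rj leqNgt lt_ri.
Qed.

Lemma reshape_index_last sh : 0 \notin sh -> 0 < sumn sh ->
  (reshape_index sh (sumn sh).-1).+1 = size sh.
Proof.
move=> sh0 n0; have lt_n : (sumn sh).-1 < sumn sh by rewrite prednK.
apply/eqP; rewrite eqn_leq reshape_indexP //.
case k: (size sh) => [//|k']; rewrite ltnS.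
have [lt_f <-] := @reshape_start sh k' sh0 ltac:(by rewrite k).
by apply: leq_reshape_index; rewrite -ltnS prednK.
Qed.

(** The first chunk is the set of positions sharing a chunk with position 0. If the first chunks had
    lengths [a < b], the positions 0 and [a] would be separated in one shape only. *)
Lemma reshape_index_inj sh1 sh2 : 0 \notin sh1 -> 0 \notin sh2 ->
  sumn sh1 = sumn sh2 ->
  (forall i j, i < j < sumn sh1 -> (reshape_index sh1 i == reshape_index sh1 j)
     = (reshape_index sh2 i == reshape_index sh2 j)) ->
  sh1 = sh2.
Proof.
elim: sh1 sh2 => [|a sh1 IH] [|b sh2] //=; rewrite ?inE ?negb_or.
- by move=> _ /andP[b0 _] /esym/eqP; rewrite addn_eq0 eq_sym (negPf b0).
- by move=> /andP[a0 _] _ /eqP; rewrite addn_eq0 eq_sym (negPf a0).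
case/andP=> a0 sh1_0 /andP[b0 sh2_0] e h.
have [a1 b1] : 0 < a /\ 0 < b by rewrite !lt0n ![_ == 0]eq_sym.
have eab : a = b.
  case: (ltngtP a b) => // [lt_ab|lt_ba].
  - have := h 0 a; rewrite !reshape_index_cons lt_ab ltnn a1 b1 /= => H.
    suff /H: a < a + sumn sh1 by [].
    by lia.
  - have := h 0 b; rewrite !reshape_index_cons lt_ba ltnn a1 b1 /= => H.
    suff /H: b < a + sumn sh1 by [].
    by lia.
rewrite -eab; congr (_ :: _); apply: IH => // [|i j ij]; first by lia.
have := h (a + i) (a + j); rewrite !reshape_index_cons -eab.
by rewrite !ltnNge !leq_addr /= !addKn !eqSS; apply; lia.
Qed.

Lemma shape_of_cuts (cut : pred nat) n : exists sh, [/\ 0 \notin sh, sumn sh = n &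
  forall i j, i <= j < n ->
    reshape_index sh i = reshape_index sh j <-> forall k, i < k <= j -> ~~ cut k].
Proof.
elim: n cut => [|n IH] cut; first by exists [::]; split=> // i j; rewrite andbF.
have [sh [sh0 sumsh h]] := IH (fun k => cut k.+1).
(* The shape of the remaining positions is known. Position 0 is a chunk of its own if there is a cut
   at 1 or nothing follows; otherwise it extends the first chunk. *)
have [c1|c1] := boolP (cut 1 || (n == 0)).
- exists (1 :: sh); split=> [||[|i] [|j] // ij]; rewrite ?inE ?negb_or //=.
  + by rewrite sumsh.
  + by split=> // _ k; lia.
  + rewrite !reshape_index_cons; split=> // /(_ 1 isT).
    by case/orP: c1 => [->//|]; lia.
  + rewrite !reshape_index_cons !subn1 /=; split=> [[/h H] k ik|H].
      by case: k ik => // k ik; apply: H; lia.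
    by congr _.+1; apply/h => [|k ik]; [lia | apply: H; lia].
case: sh sh0 sumsh h => [|a sh] /=; first by lia.
rewrite inE negb_or => /andP[a0 sh0] sumsh h.
exists (a.+1 :: sh); split=> [||[|i] [|j] // ij]; rewrite ?inE ?negb_or //=; first by lia.
- by split=> // _ k; lia.
- have := h 0 j ij; rewrite !reshape_index_cons subSS ltnS lt0n eq_sym a0 /= => H.
  split=> [/H Hk k ik|Hk].
    by case: k ik => [|[|k]] // ik; [rewrite negb_or in c1; case/andP: c1 | apply: Hk].
  by apply/H => k ik; apply: Hk; lia.
- rewrite !reshape_index_cons !subSS !ltnS -!reshape_index_cons.
  split=> [/h H k ik|H].
    by case: k ik => // k ik; apply: H; lia.
  by apply/h => [|k ik]; [lia | apply: H; lia].
Qed.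

Lemma count_flatten_index (p : nat -> pred nat) bs :
  count (fun i => p (reshape_index (shape bs) i) (flatten bs)`@i)
    (iota 0 (size (flatten bs)))
  = sumn (mkseq (fun r => count (p r) (nth [::] bs r)) (size bs)).
Proof.
elim: bs p => //= b bs IH p.
rewrite size_cat iotaD count_cat /= add0n; congr (_ + _).
  rewrite (count_nth (p 0)); apply: eq_in_count => i; rewrite mem_iota /= => ib.
  by rewrite reshape_index_cons ib nth_cat ib.
rewrite -[X in iota X](addn0 (size b)) iotaDl count_map.
rewrite (iotaDl 1 0) -map_comp -/(mkseq _ _) -(IH (fun r => p r.+1)).
apply: eq_count => i /=; rewrite reshape_index_cons nth_cat.
by rewrite ltnNge leq_addr /= addKn.
Qed.

(** * Blocks *)

(** The direction is a parameter so that lower and upper, and direct and skew sums, share their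
    proofs. *)
Definition ltd (d : bool) x y := if d then x < y else y < x.

Lemma ltd_neq d x y : ltd d x y -> x <> y.
Proof. by case: d => /= + e; rewrite e ltnn. Qed.

Lemma ltd_dir d d' x y : ltd d x y -> ltd d' x y -> d = d'.
Proof. by case: d; case: d' => //=; case: ltngtP. Qed.

Lemma ltd_sym d x y : ltd (~~ d) x y = ltd d y x.
Proof. by case: d. Qed.

Lemma neq_ltd x y : x != y -> exists d, ltd d x y.
Proof. by rewrite neq_ltn => /orP[?|?]; [exists true | exists false]. Qed.

(* On a Cayley permutation these are the H-intervals, as sets of positions. *)
Definition block w A : Prop :=
  [/\ exists2 i, i < size w & A i,
      forall i j k, i <= j <= k -> k < size w -> A i -> A k -> A j
    & forall i, i < size w -> ~~ A i ->
        exists d, forall j, j < size w -> A j -> ltd d w`@i w`@j].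

Definition nonfull w A : Prop := exists2 i, i < size w & ~~ A i.

Definition simplew w : Prop :=
  forall A, block w A -> nonfull w A ->
    forall i j, i < size w -> j < size w -> A i -> A j -> i = j.

(** The word is a direct sum ([d] true) or a skew sum ([d] false) whose first summand has length
    [k]. *)
Definition cut d w k : Prop :=
  0 < k < size w /\
  forall i j, i < k -> k <= j < size w -> ltd d w`@i w`@j.

(** This replaces the maximal proper blocks: in a word of length at least two without cuts it is an
    equivalence relation on positions, whose classes are these blocks and the remaining single
    positions. *)
Definition joined w i j : Prop :=
  i = j \/ exists A, [/\ block w A, nonfull w A, A i & A j].

(** The common position [k] makes an outside position lie on the same side of [A] as of [B], and it
    links the two intervals. *)
Lemma block_union w A B k : block w A -> block w B ->
  k < size w -> A k -> B k -> block w (predU A B).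
Proof.
move=> [_ cA uA] [_ cB uB] kw Ak Bk; split.
- by exists k => //=; rewrite Ak.
- move=> i j l ijl lw /= /orP[Ai|Bi] /orP[Al|Bl].
  + by rewrite (cA i j l).
  + case: (leqP j k) => jk; first by rewrite (cA i j k) //; lia.
    by rewrite (cB k j l) ?orbT //; lia.
  + case: (leqP j k) => jk; first by rewrite (cB i j k) ?orbT //; lia.
    by rewrite (cA k j l) //; lia.
  + by rewrite (cB i j l) ?orbT.
- move=> i iw /=; rewrite negb_or => /andP[/(uA _ iw)[d dA] /(uB _ iw)[d' dB]].
  have edd := ltd_dir (dA k kw Ak) (dB k kw Bk).
  rewrite -edd in dB.
  by exists d => j jw /orP[/dA|/dB]; apply.
Qed.

(** Here [B] turns out to be a suffix, starting at [m], and everything before [m] lies in [A]. As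
    [x] is in [B] but outside [A], all of [A] is on one side of it; hence each position before [m],
    being outside [B], lies on that same side of the whole of [B]. So [m] is a cut. *)
Lemma covering_blocks_cut w A B k x y : block w A -> block w B ->
  (forall i, i < size w -> A i || B i) ->
  k < size w -> A k -> B k -> x < size w -> ~~ A x -> y < size w -> ~~ B y -> y < k ->
  exists d m, cut d w m.
Proof.
move=> [_ cA uA] [_ cB uB] AB kw Ak Bk xw Ax yw By yk.
have Bx : B x by have := AB x xw; rewrite (negPf Ax).
have Ay : A y by have := AB y yw; rewrite (negPf By) orbF.
(* Otherwise [B] lies strictly between [y] and [j], both in [A]. Then so does [x], which contradicts
   that [A] is an interval missing [x]. *)
have ky j : j < size w -> ~~ B j -> j < k.
  move=> jw Bj; rewrite ltnNge; apply/negP => kj.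
  have Aj : A j by have := AB j jw; rewrite (negPf Bj) orbF.
  case: (leqP x k) => xk.
    case: (leqP x y) => xy.
      by move: By; rewrite (cB x y k) //; lia.
    by move: Ax; rewrite (cA y x k) //; lia.
  case: (leqP x j) => xj.
    by move: Ax; rewrite (cA k x j) //; lia.
  by move: Bj; rewrite (cB k j x) //; lia.
have exB : exists i, (i < size w) && B i by exists k; rewrite kw.
case: (ex_minnP exB) => m /andP[mw Bm] minm.
have mk : m <= k by apply: minm; rewrite kw.
have ltm i : i < m -> ~~ B i.
  move=> im; apply/negP => Bi; have := minm i.
  by rewrite Bi (ltn_trans im mw) => /(_ isT); rewrite leqNgt im.
have lem j : m <= j -> j < size w -> B j.
  move=> mj jw; apply/negPn/negP => Bj; have jk := ky j jw Bj.
  by move: Bj; rewrite (cB m j k) //; lia.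
have [d dA] := uA x xw Ax.
exists (~~ d), m; split.
  rewrite mw andbT lt0n; apply/eqP => m0.
  by move: By; rewrite lem // m0.
move=> i j im /andP[mj jw].
have iw := ltn_trans im mw; have Bi := ltm i im.
have Ai : A i by have := AB i iw; rewrite (negPf Bi) orbF.
have [d' dB] := uB i iw Bi.
have := dB x xw Bx; have := dA i iw Ai; rewrite -(ltd_sym d) => h1 h2.
by rewrite (ltd_dir h1 h2); apply: dB => //; apply: lem.
Qed.

Lemma block_union_proper w A B k : (forall d m, ~ cut d w m) ->
  block w A -> nonfull w A -> block w B -> nonfull w B ->
  k < size w -> A k -> B k -> nonfull w (predU A B).
Proof.
move=> nocut bA [x xw Ax] bB [y yw By] kw Ak Bk.
apply: contrapT => nprop.
have AB i : i < size w -> A i || B i.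
  by move=> iw; apply/negPn/negP => nAB; apply: nprop; exists i.
have [d [m cm]] : exists d m, cut d w m; last exact: nocut cm.
case: (ltngtP y k) => [yk|ky|eyk]; last by rewrite eyk Bk in By.
  exact: (covering_blocks_cut bA bB AB kw Ak Bk xw Ax yw By yk).
have BA i : i < size w -> B i || A i by rewrite orbC; apply: AB.
case: (ltngtP x k) => [xk|kx|exk]; last by rewrite exk Ak in Ax.
  exact: (covering_blocks_cut bB bA BA kw Bk Ak yw By xw Ax xk).
(* Both missed positions are now to the right of [k]. The nearer one lies between [k] and the other,
   hence in the block that was to miss it. *)
have [[_ cA _] [_ cB _]] := (bA, bB).
have Bx : B x by have := AB x xw; rewrite (negPf Ax).
have Ay : A y by have := AB y yw; rewrite (negPf By) orbF.
case: (leqP x y) => xy; first by move: Ax; rewrite (cA k x y) //; lia.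
by move: By; rewrite (cB k y x) //; lia.
Qed.

Lemma joined_sym w i j : joined w i j -> joined w j i.
Proof. by case=> [->|[A []]]; [left | right; exists A]. Qed.

Lemma joined_trans w i j k : (forall d m, ~ cut d w m) -> j < size w ->
  joined w i j -> joined w j k -> joined w i k.
Proof.
move=> nocut jw [->//|[A [bA pA Ai Aj]]] [<-|[B [bB pB Bj Bk]]]; right.
  by exists A.
exists (predU A B); split=> /=; rewrite ?Ai ?Bk ?orbT //.
  exact: block_union bA bB jw Aj Bj.
exact: block_union_proper bA pA bB pB jw Aj Bj.
Qed.

Lemma joined_convex w i j k l : i <= j <= k -> k <= l -> l < size w ->
  joined w i l -> joined w j k.
Proof.
move=> ijk kl lw [e|[A [bA pA Ai Al]]]; first by left; lia.
right; exists A; split=> //; have [_ cA _] := bA.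
  by apply: (cA i j l) => //; lia.
by apply: (cA i k l) => //; lia.
Qed.

Lemma joined_block w i : (forall d m, ~ cut d w m) -> 1 < size w -> i < size w ->
  (forall j, j < size w -> joined w i j -> j = i) \/
  block w (fun j => `[< joined w i j >]) /\ nonfull w (fun j => `[< joined w i j >]).
Proof.
move=> nocut w1 iw.
have [single|] := pselect (forall j, j < size w -> joined w i j -> j = i); first by left.
move/existsNP => [j0 /not_implyP[j0w /not_implyP[ij0 nj0]]]; right; split; first split.
- by exists i => //; apply/asboolP; left.
- move=> j k l jkl lw /asboolP ij /asboolP il; apply/asboolP.
  have jw : j < size w by lia.
  have jl := joined_trans nocut iw (joined_sym ij) il.
  apply: joined_trans (jw) ij _ => //.
  by apply: joined_convex jl => //; lia.
- move=> j jw /asboolP nij.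
  (* One block through [i] fixes the side on which [j] lies; every other block in the class contains
     [i] too, so its side is the same. *)
  have [A0 [bA0 pA0 A0i A0j]] : exists A, [/\ block w A, nonfull w A, A i & A j0].
    by case: ij0 => // e; rewrite e in nj0.
  have nA A : block w A -> nonfull w A -> A i -> ~~ A j.
    by move=> bA pA Ai; apply/negP => Aj; apply: nij; right; exists A.
  have [_ _ uA0] := bA0; have [d0 dA0] := uA0 j jw (nA A0 bA0 pA0 A0i).
  exists d0 => k kw /asboolP[<-|[A [bA pA Ai Ak]]]; first exact: dA0.
  have [_ _ uA] := bA; have [d dA] := uA j jw (nA A bA pA Ai).
  by rewrite (ltd_dir (dA0 i iw A0i) (dA i iw Ai)); apply: dA.
(* If the class were everything, the first and the last position would lie in a common proper block,
   which by convexity would be the whole word. *)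
- apply: contrapT => /forall2NP nprop.
  have all_ij j : j < size w -> joined w i j.
    by move=> jw; case: (nprop j) => // /negP/negPn/asboolP.
  have /joined_sym i0 := all_ij 0 (ltnW w1).
  have iN := all_ij (size w).-1 ltac:(lia).
  have [|[A [[_ cA _] [k kw /negP Ak] A0 AN]]] := joined_trans nocut iw i0 iN; first by lia.
  by apply: Ak; apply: (cA 0 k (size w).-1) => //; lia.
Qed.

(** * Inflations *)

Local Notation chunk bs i := (reshape_index (shape bs) i).

Definition infl s bs w : Prop :=
  [/\ size w = size (flatten bs), size s = size bs
    & forall i j, i < size w -> j < size w ->
        (w`@i < w`@j) = if chunk bs i == chunk bs j
                        then (flatten bs)`@i < (flatten bs)`@j
                        else s`@(chunk bs i) < s`@(chunk bs j)].

(** A chunk that is a block is strictly separated from all values outside it, so its letter in [s]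
    occurs once. A repeated letter can only stand for a single position, that is, for the block
    [[:: 0]]. *)
Definition legal s bs : Prop :=
  [/\ size s = size bs, 0 \notin shape bs
    & forall r, r < size s -> ~~ uniqv s s`@r -> nth [::] bs r = [:: 0]].

(** A two-digit number in base [N], larger than every letter of the blocks: the letter of [s] is the
    high digit, the letter of the block the low one. *)
Definition inflate s bs : seq nat :=
  let N := (\max_(x <- flatten bs) x).+1 in
  std (mkseq (fun i => s`@(chunk bs i) * N + (flatten bs)`@i) (size (flatten bs))).

Lemma inflate_cay s bs : cay (inflate s bs).
Proof. exact: std_cay. Qed.

Lemma chunk_lt bs i : i < size (flatten bs) -> chunk bs i < size bs.
Proof. by rewrite size_flatten => /reshape_indexP; rewrite size_map. Qed.

Lemma chunk_start bs r : 0 \notin shape bs -> r < size bs ->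
  exists2 i, i < size (flatten bs) & chunk bs i = r.
Proof.
move=> bs0 rbs; exists (flatten_index (shape bs) r 0); rewrite ?size_flatten.
  by apply: (reshape_start bs0 _).1; rewrite size_map.
by apply: (reshape_start bs0 _).2; rewrite size_map.
Qed.

Lemma chunk_single bs i j : i < size (flatten bs) -> j < size (flatten bs) ->
  chunk bs i = chunk bs j -> size (nth [::] bs (chunk bs i)) = 1 -> i = j.
Proof.
move=> ibs jbs e s1.
have o0 k : k < size (flatten bs) -> chunk bs k = chunk bs i ->
    reshape_offset (shape bs) k = 0.
  rewrite size_flatten => kbs ek; have := reshape_offsetP kbs.
  rewrite ek (nth_map [::]) ?s1 ?chunk_lt //.
  by case: (reshape_offset _ _).
by rewrite -(reshape_indexK (shape bs) i) -(reshape_indexK (shape bs) j) -e !o0.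
Qed.

Lemma inflateP s bs : legal s bs -> infl s bs (inflate s bs).
Proof.
move=> [sz bs0 leg]; rewrite /inflate; set N := _.+1; set W := mkseq _ _.
have [e h] := std_pat W; split=> // [|i j]; first by rewrite e size_mkseq.
rewrite size_std size_mkseq => ibs jbs; rewrite h ?size_std ?size_mkseq // !nth_mkseq //.
have ltN k : k < size (flatten bs) -> (flatten bs)`@k < N.
  by move=> kbs; rewrite ltnS; apply: leq_bigmax_seq; rewrite ?mem_nth.
have cmp a b x y : x < N -> y < N ->
    (a * N + x < b * N + y) = if a == b then x < y else a < b.
  move=> xN yN; case: (ltngtP a b) => [ab|ba|->]; last by rewrite ltn_add2l.
    by have := leq_mul2r N a.+1 b; rewrite ab orbT mulSn; lia.
  by have := leq_mul2r N b.+1 a; rewrite ba orbT mulSn; lia.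
rewrite cmp ?ltN //.
case: eqP => [es|nes]; case: eqP => [ec|nec] //; last by rewrite ec in nes.
(* What remains is two chunks with the same letter of [s]. That letter is repeated, so legality
   makes both low digits 0 and the two values are equal, as the comparison rule demands. *)
have leg0 k : k < size (flatten bs) -> ~~ uniqv s s`@(chunk bs k) -> (flatten bs)`@k = 0.
  move=> kbs nu; rewrite nth_flatten leg ?sz ?chunk_lt //.
  by case: (reshape_offset _ _) => [|[]].
have si : chunk bs i < size s by rewrite sz chunk_lt.
have sj : chunk bs j < size s by rewrite sz chunk_lt.
rewrite es ltnn !leg0 //; apply/negP => /(uniqv_nthP) => U.
  by apply: nec; apply: U.
by apply: nec; apply/esym; apply: U.
Qed.

Lemma infl_pat s bs w w' : infl s bs w -> infl s bs w' -> pat w w'.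
Proof.
move=> [e _ h] [e' _ h']; split=> [|i j iw jw]; first by rewrite e e'.
by rewrite h // h' // e' -e.
Qed.

Lemma infl_cay s bs w : legal s bs -> cay w -> infl s bs w -> w = inflate s bs.
Proof.
move=> leg cw iw; apply: cay_pat_inj => //; first exact: inflate_cay.
exact: infl_pat iw (inflateP leg).
Qed.

Lemma infl_eq s bs w i j : infl s bs w -> i < size w -> j < size w ->
  (w`@i == w`@j) = if chunk bs i == chunk bs j
                   then (flatten bs)`@i == (flatten bs)`@j
                   else s`@(chunk bs i) == s`@(chunk bs j).
Proof.
move=> [_ _ h] iw jw; rewrite nth_eqlt !h // eq_sym.
by case: eqP => _; rewrite nth_eqlt.
Qed.

Lemma infl_ltd d s bs w i j : infl s bs w -> i < size w -> j < size w ->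
  chunk bs i <> chunk bs j ->
  ltd d w`@i w`@j = ltd d s`@(chunk bs i) s`@(chunk bs j).
Proof.
move=> [_ _ h] iw jw /eqP/negPf nc.
by case: d; rewrite /= h // ?nc // eq_sym nc.
Qed.

Lemma chunk_pos bs r c (i := flatten_index (shape bs) r c) :
  r < size bs -> c < size (nth [::] bs r) ->
  [/\ i < size (flatten bs), chunk bs i = r & (flatten bs)`@i = (nth [::] bs r)`@c].
Proof.
move=> rbs cr; have cr' : c < (shape bs)`@r by rewrite (nth_map [::]).
rewrite size_flatten nth_flatten /i flatten_indexKl // flatten_indexKr //.
by split=> //; apply: flatten_indexP.
Qed.

Lemma chunk_nth bs i : i < size (flatten bs) ->
  reshape_offset (shape bs) i < size (nth [::] bs (chunk bs i)).
Proof.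
move=> ibs; have := ibs; rewrite size_flatten => /reshape_offsetP.
by rewrite (nth_map [::]) // chunk_lt.
Qed.

Lemma infl_prim s bs w : 0 \notin shape bs -> infl s bs w ->
  prim w <-> prim s /\ forall u, u \in bs -> prim u.
Proof.
move=> bs0 iw; have [sw ss _] := iw.
split=> [/primP pw|[/primP ps pbs]]; first split.
- apply/primP => r rs; have rbs : r < size bs by rewrite -ss ltnW.
  have nr k : k < size bs -> 0 < size (nth [::] bs k).
    move=> kbs; rewrite lt0n; apply: contraNneq bs0 => <-.
    by rewrite -(nth_map [::] 0 size) // mem_nth ?size_map.
  have [] := @chunk_pos bs r (size (nth [::] bs r)).-1 rbs; first by rewrite prednK ?nr.
  have [] := @chunk_pos bs r.+1 0; rewrite -?ss ?nr -?ss //.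
  have -> : flatten_index (shape bs) r.+1 0 =
            (flatten_index (shape bs) r (size (nth [::] bs r)).-1).+1.
    rewrite /flatten_index (take_nth 0) ?size_map // sumn_rcons addn0 (nth_map [::]) //.
    by rewrite -addnS prednK ?nr.
  move: (flatten_index _ _ _) => i ibs c1 _ ibs' c0 _.
  have := pw i; rewrite sw ibs => /(_ isT).
  by rewrite (infl_eq iw) ?sw // c0 c1 ltn_eqF.
- move=> u /(nthP [::])[r rbs <-]; apply/primP => c cr.
  have [] := chunk_pos rbs cr; have [] := chunk_pos rbs (ltnW cr).
  rewrite {4 5 6}/flatten_index addnS -/(flatten_index _ _ _).
  move: (flatten_index _ _ _) => i ibs c0 e0 ibs' c1 e1.
  have := pw i; rewrite sw ibs' => /(_ isT).
  by rewrite (infl_eq iw) ?sw // c0 c1 eqxx e0 e1.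
apply/primP => i; rewrite sw => ibs; have ibs' := ltnW ibs.
rewrite (infl_eq iw) ?sw //; case: eqP => [ec|/eqP nc].
  have := reshape_indexK (shape bs) i; have := reshape_indexK (shape bs) i.+1.
  rewrite !nth_flatten -ec /flatten_index => e1 e0.
  have eo : reshape_offset (shape bs) i.+1 = (reshape_offset (shape bs) i).+1 by lia.
  have := pbs (nth [::] bs (chunk bs i)); rewrite mem_nth ?chunk_lt // => /(_ isT)/primP.
  by rewrite eo; apply; rewrite -eo ec chunk_nth.
have ec : chunk bs i.+1 = (chunk bs i).+1.
  apply/eqP; rewrite eqn_leq reshape_indexS -?size_flatten //=.
  by rewrite ltn_neqAle nc leq_reshape_index.
by rewrite ec; apply: ps; rewrite -ec ss chunk_lt.
Qed.

Lemma infl_uniqv s bs w i : 0 \notin shape bs -> infl s bs w -> i < size w ->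
  uniqv w w`@i = uniqv s s`@(chunk bs i)
                 && uniqv (nth [::] bs (chunk bs i)) (flatten bs)`@i.
Proof.
move=> bs0 iw ilt; have [sw ss _] := iw.
have ibs : i < size (flatten bs) by rewrite -sw.
have oi := chunk_nth ibs.
have si : chunk bs i < size s by rewrite ss chunk_lt.
rewrite nth_flatten; apply/(uniqv_nthP ilt)/andP => [U|[/(uniqv_nthP si) U /(uniqv_nthP oi) V]].
- split; [apply/(uniqv_nthP si) | apply/(uniqv_nthP oi)].
  + move=> r; rewrite ss => rbs er; have [j jbs jr] := chunk_start bs0 rbs.
    apply/eqP/negPn/negP => nr; have ji : j = i.
      apply: U; first by rewrite sw.
      by apply/eqP; rewrite (infl_eq iw) ?sw // jr (negPf nr) er.
    by move: nr; rewrite -jr ji eqxx.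
  + move=> c cr ec; have [jbs jr jc] := chunk_pos (chunk_lt ibs) cr.
    have ji : flatten_index (shape bs) (chunk bs i) c = i.
      apply: U; first by rewrite sw.
      by apply/eqP; rewrite (infl_eq iw) ?sw // jr eqxx jc ec nth_flatten.
    by rewrite -[in RHS]ji flatten_indexKr // (nth_map [::]) ?chunk_lt.
- move=> j jlt /eqP; rewrite (infl_eq iw) //.
  have jbs : j < size (flatten bs) by rewrite -sw.
  case: eqP => [ec|nc /eqP e]; last by case: nc; apply: U; rewrite ?ss ?chunk_lt.
  rewrite !nth_flatten ec => /eqP/V eo.
  rewrite -(reshape_indexK (shape bs) i) -(reshape_indexK (shape bs) j) ec eo //.
  by rewrite -ec chunk_nth.
Qed.

Lemma infl_nuniq s bs w : 0 \notin shape bs -> infl s bs w ->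
  nuniq w = sumn (mkseq (fun r => if uniqv s s`@r then nuniq (nth [::] bs r) else 0)
                        (size bs)).
Proof.
move=> bs0 iw; have [sw ss _] := iw.
pose p r x := uniqv s s`@r && uniqv (nth [::] bs r) x.
rewrite /nuniq (count_nth _ w) sw.
transitivity (sumn (mkseq (fun r => count (p r) (nth [::] bs r)) (size bs))).
  rewrite -count_flatten_index; apply: eq_in_count => i; rewrite mem_iota /= => ibs.
  by rewrite (infl_uniqv bs0 iw) ?sw.
congr sumn; apply: eq_mkseq => r; rewrite /p.
by case: uniqv => //; rewrite count_pred0.
Qed.

(** Once the shapes agree, comparisons between chunks of [w] determine [s] up to order isomorphism,
    and comparisons inside a chunk determine its block. *)
Lemma infl_inj s bs s' bs' w : infl s bs w -> infl s' bs' w ->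
  shape bs = shape bs' -> 0 \notin shape bs -> cay s -> cay s' ->
  (forall u, u \in bs -> cay u) -> (forall u, u \in bs' -> cay u) ->
  s = s' /\ bs = bs'.
Proof.
move=> [sw ss h] [sw' ss' h'] esh bs0 cs cs' cbs cbs'.
have sbs : size bs = size bs' by have := congr1 size esh; rewrite !size_map.
have nbs r : r < size bs -> size (nth [::] bs r) = size (nth [::] bs' r).
  by move=> rbs; have := congr1 (nth 0 ^~ r) esh; rewrite !(nth_map [::]) -?sbs.
split.
  apply: cay_pat_inj => //; split=> [|r r' rs rs']; first by rewrite ss ss' sbs.
  have [->|nr] := eqVneq r r'; first by rewrite !ltnn.
  rewrite ss in rs rs'.
  have [i ibs ir] := chunk_start bs0 rs; have [j jbs jr] := chunk_start bs0 rs'.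
  have := h' i j; have := h i j; rewrite -esh ir jr (negPf nr) sw => H H'.
  by rewrite -H // -H'.
apply: (@eq_from_nth _ [::]) => // r rbs; have rbs' : r < size bs' by rewrite -sbs.
apply: cay_pat_inj; [by apply: cbs; rewrite mem_nth | by apply: cbs'; rewrite mem_nth |].
split=> [|c d cr dr]; first exact: nbs.
have [ibs ir <-] := chunk_pos rbs cr; have [jbs jr <-] := chunk_pos rbs dr.
have [ibs' ir' <-] := chunk_pos rbs' (leq_trans cr (eq_leq (nbs r rbs))).
have [jbs' jr' <-] := chunk_pos rbs' (leq_trans dr (eq_leq (nbs r rbs))).
rewrite -esh in ir' jr' *.
have := h (flatten_index (shape bs) r c) (flatten_index (shape bs) r d).
have := h' (flatten_index (shape bs) r c) (flatten_index (shape bs) r d).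
rewrite -esh ir jr eqxx sw => H' H.
by rewrite -H // -H'.
Qed.

Lemma infl_block s bs w B : 0 \notin shape bs -> infl s bs w ->
  block s B -> block w (fun i => B (chunk bs i)).
Proof.
move=> bs0 iw [[r rs Br] cB uB]; have [sw ss _] := iw; split.
- rewrite ss in rs; have [i ibs ir] := chunk_start bs0 rs.
  by exists i; rewrite ?sw ?ir.
- move=> i j k /andP[ij jk] kw; apply: cB; last by rewrite ss chunk_lt -?sw.
  by rewrite !leq_reshape_index.
- move=> i iw' nB; have [|d dB] := uB _ _ nB; first by rewrite ss chunk_lt -?sw.
  exists d => j jw Bj; rewrite (infl_ltd d iw) // => [|e]; last by rewrite e Bj in nB.
  by apply: dB; rewrite // ss chunk_lt -?sw.
Qed.

Lemma infl_joined_chunk s bs w i j : legal s bs -> infl s bs w -> 1 < size s ->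
  i < size w -> j < size w -> chunk bs i = chunk bs j -> joined w i j.
Proof.
move=> [_ bs0 leg] iw s1 ilt jlt ec; have [sw ss _] := iw.
have [->|/eqP nij] := eqVneq i j; first by left.
have ibs : i < size (flatten bs) by rewrite -sw.
have jbs : j < size (flatten bs) by rewrite -sw.
have rs : chunk bs i < size s by rewrite ss chunk_lt.
have U : uniqv s s`@(chunk bs i).
  apply/negPn/negP => nU; apply: nij; apply: (chunk_single ibs jbs ec).
  by rewrite leg.
right; exists (fun k => chunk bs k == chunk bs i); rewrite ec eqxx; split=> //; last first.
  (* The boolean read as a number, 1 or 0, is an index different from [chunk bs j]. It exists since
     [s] has at least two letters. *)
  have r'bs : (chunk bs j == 0) < size bs by rewrite -ss; lia.
  have [k kbs kr] := chunk_start bs0 r'bs; exists k; rewrite ?sw // kr.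
  by case: (chunk bs j).
rewrite -ec; apply: (@infl_block s bs w (pred1 (chunk bs i))) => //.
split; first by exists (chunk bs i) => //=.
  by move=> a b c abc cs /eqP ea /eqP ec' /=; lia.
move=> r rs' /= nr; have [d rd] : exists d, ltd d s`@r s`@(chunk bs i).
  apply: neq_ltd; apply: contraNneq nr => e; apply/eqP.
  exact: (uniqv_nthP rs U).
by exists d => k _ /eqP->.
Qed.

(** The chunks met by a proper block [A] form a block of [s], so [A] stays inside one chunk or meets
    all of them. In the second case [A] misses an end position of [w]. All letters of [s] other than
    the one at that end are then on the same side of it, so they form a proper block; it has at
    least two letters because [s] has at least three, against simplicity. *)
Lemma infl_joined s bs w i j : legal s bs -> infl s bs w ->
  simplew s -> 2 < size s -> i < size w -> j < size w ->
  joined w i j <-> chunk bs i = chunk bs j.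
Proof.
move=> leg iw sim s3 ilt jlt; split; last exact: infl_joined_chunk (ltnW s3) _ _.
have [_ bs0 _] := leg; have [sw ss _] := iw.
case=> [->//|[A [[_ cA uA] [x xw Ax] Ai Aj]]].
have chw k : k < size w -> chunk bs k < size s by rewrite sw ss; apply: chunk_lt.
pose B r := `[< exists k, [/\ k < size w, A k & chunk bs k = r] >].
have bB : block s B.
  split; first by exists (chunk bs i); [apply: chw | apply/asboolP; exists i].
  - move=> r1 r r2 r12 r2s /asboolP[k1 [k1w Ak1 e1]] /asboolP[k2 [k2w Ak2 e2]].
    have rs : r < size bs by rewrite -ss; lia.
    have [k kbs ek] := chunk_start bs0 rs; apply/asboolP.
    have [e|n1] := eqVneq r r1; first by exists k1; rewrite e.
    have [e|n2] := eqVneq r r2; first by exists k2; rewrite e.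
    exists k; split; rewrite ?sw //; apply: (cA k1 k k2) => //; apply/andP; split.
    + by rewrite leqNgt; apply/negP => /ltnW/(leq_reshape_index (shape bs)); lia.
    + by rewrite leqNgt; apply/negP => /ltnW/(leq_reshape_index (shape bs)); lia.
  - move=> r; rewrite ss => rbs nB; have [k kbs ek] := chunk_start bs0 rbs.
    have nAk : ~~ A k by apply: contra nB => Ak; apply/asboolP; exists k; rewrite sw.
    have [|d dA] := uA k _ nAk; first by rewrite sw.
    exists d => r' r's /asboolP[k' [k'w Ak' e']].
    rewrite -ek -e' -(infl_ltd d iw) ?sw -?sw ?dA //; first by rewrite sw.
    rewrite ek e' => err; case/negP: nB; rewrite err; apply/asboolP.
    by exists k'.
have [pB|nB] := pselect (nonfull s B).
  by apply: (sim B) => //; rewrite ?chw //; apply/asboolP; [exists i | exists j].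
have allB r : r < size s -> exists k, [/\ k < size w, A k & chunk bs k = r].
  by move=> rs; apply/asboolP/negPn/negP => nBr; apply: nB; exists r.
exfalso.
(* If A misses the first or the last chunk, the other chunks form a block of s. *)
have key y : y < size w -> ~~ A y ->
    (forall a b c, a <= b <= c -> c < size s -> a != chunk bs y ->
       c != chunk bs y -> b != chunk bs y) -> False.
  move=> yw Ay cvx; have [d dA] := uA y yw Ay.
  have ys := chw y yw.
  have bC : block s (fun r => r != chunk bs y).
    split=> //; first by exists (chunk bs y == 0); [lia | case: (chunk bs y)].
    move=> r rs; rewrite negbK => /eqP->; exists d => r' r's nr'.
    have [k [kw Ak ek]] := allB r' r's; rewrite -ek -(infl_ltd d iw) // ?dA //.
    by rewrite ek => e; rewrite e eqxx in nr'.
  have pC : nonfull s (fun r => r != chunk bs y) by exists (chunk bs y); rewrite ?eqxx.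
  have H a b := sim _ bC pC a b.
  case: (chunk bs y) H ys => [|[|r]] H ys.
  - by have := H 1 2; lia.
  - by have := H 0 2; lia.
  - by have := H 0 1; lia.
have n0 : 0 < size w by case: (size w) xw.
have [xi|ix] := ltnP x i.
  have nA0 : ~~ A 0 by apply: contra Ax => A0; apply: (cA 0 x i) => //; lia.
  apply: (key 0 n0 nA0) => a b c abc cs.
  have b0 : 0 < size bs by rewrite -ss; lia.
  have [k kbs ek] := chunk_start bs0 b0.
  have := leq_reshape_index (shape bs) (leq0n k); rewrite ek; lia.
have lt_n : (size w).-1 < size w by rewrite prednK.
have nAn : ~~ A (size w).-1.
  by apply: contra Ax => An; apply: (cA i x (size w).-1) => //; lia.
apply: (key _ lt_n nAn) => a b c abc cs.
have := reshape_index_last bs0; rewrite -size_flatten -sw size_map -ss => /(_ n0); lia.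
Qed.

(** * Cuts and the contraction of blocks *)

Lemma cut_blocks d w k : cut d w k ->
  [/\ block w (fun i => i < k), block w (fun i => k <= i),
      nonfull w (fun i => i < k) & nonfull w (fun i => k <= i)].
Proof.
case=> /andP[k0 kw] c; split.
- split; first by exists 0 => //; lia.
    by move=> a b e abe ew ak ek; lia.
  move=> i iw ik; exists (~~ d) => j jw jk; rewrite ltd_sym; apply: c => //.
  by rewrite leqNgt ik.
- split; first by exists k.
    by move=> a b e abe ew ak ek; lia.
  move=> i iw ik; exists d => j jw jk; apply: c => //; last by rewrite jk.
  by rewrite ltnNge.
- by exists k; rewrite ?ltnn.
- by exists 0; [lia | rewrite -ltnNge].
Qed.

(** Both sides of a cut are proper blocks, so each would lie in a single chunk; this leaves at most
    two chunks. *)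
Lemma infl_nocut s bs w d k : legal s bs -> infl s bs w ->
  simplew s -> 2 < size s -> ~ cut d w k.
Proof.
move=> leg iw sim s3 c; have [b1 b2 p1 p2] := cut_blocks c; have [/andP[k0 kw] _] := c.
have [_ bs0 _] := leg; have [sw ss _] := iw.
have e1 : chunk bs 0 = chunk bs k.-1.
  by apply/(infl_joined leg iw sim s3); try lia; right; exists (fun i => i < k); split=> //; lia.
have e2 : chunk bs k = chunk bs (size w).-1.
  by apply/(infl_joined leg iw sim s3); try lia; right; exists (fun i => k <= i); split=> //; lia.
have n0 : 0 < size w by lia.
have := reshape_index_last bs0; rewrite -size_flatten -sw size_map -ss => /(_ n0).
have := @reshape_indexS _ k.-1 bs0; rewrite prednK // -size_flatten -sw => /(_ kw).
have b0 : 0 < size bs by rewrite -ss; lia.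
have [j jbs ej] := chunk_start bs0 b0.
have := leq_reshape_index (shape bs) (leq0n j); rewrite ej; lia.
Qed.

Lemma cay_size1 u : cay u -> size u = 1 -> u = [:: 0].
Proof.
case: u => [|x []] //= cu _.
by have := cay_lt cu (mem_head _ _); rewrite /= ltnS leqn0 => /eqP->.
Qed.

(** Since each chunk is a block or a single position, comparisons between chunks do not depend on
    the representatives. The first letters of the chunks, standardised, give [s], and the
    standardised chunks give [bs]. A chunk whose letter is repeated in [s] cannot be a block, so it
    is a single position. *)
Lemma infl_exists w sh : 0 \notin sh -> sumn sh = size w ->
  (forall i, i < size w ->
     (forall j, j < size w -> reshape_index sh j = reshape_index sh i -> j = i) \/
     block w (fun j => reshape_index sh j == reshape_index sh i)) ->
  exists s bs, [/\ shape bs = sh, cay s, forall u, u \in bs -> cay u,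
                   legal s bs & infl s bs w].
Proof.
move=> sh0 sumsh fib.
pose st r := flatten_index sh r 0.
have stP r : r < size sh -> st r < size w /\ reshape_index sh (st r) = r.
  by rewrite -sumsh; apply: reshape_start.
pose h := mkseq (fun r => w`@(st r)) (size sh).
pose bs := map std (reshape sh w).
have ebs : shape bs = sh.
  rewrite /bs /shape -map_comp -[RHS](@reshapeKl _ sh w) ?sumsh //.
  by apply: eq_map => u /=; rewrite size_std.
have szbs : size bs = size sh by rewrite -(size_map size bs) -/(shape bs) ebs.
have cross i j j' : i < size w -> j < size w -> j' < size w ->
    reshape_index sh j = reshape_index sh j' -> reshape_index sh i <> reshape_index sh j ->
    (w`@i < w`@j) = (w`@i < w`@j') /\ (w`@j < w`@i) = (w`@j' < w`@i).
  move=> iw jw j'w ej nij; case: (fib j jw) => [/(_ j' j'w)->//|[_ _ u]].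
  have [|d dA] := u i iw; first by apply/eqP.
  have := dA j jw (eqxx _); have := dA j' j'w; rewrite -ej eqxx => /(_ isT).
  by case: d {dA} => /=; lia.
have cbs u : u \in bs -> cay u by move=> /mapP[v _ ->]; apply: std_cay.
exists (std h), bs; split=> //; first exact: std_cay.
- split; rewrite ?ebs ?size_std ?size_mkseq ?szbs // => r rs nU.
  have [stw str] := stP r rs.
  have [|b] := fib _ stw.
    move=> sing; apply: cay_size1.
      by apply: cbs; rewrite mem_nth ?szbs.
    have -> : size (nth [::] bs r) = sh`@r.
      by rewrite -(nth_map [::] 0 size) ?szbs // -/(shape bs) ebs.
    case e: (sh`@r) => [|[|m]] //.
      by case/negP: sh0; rewrite -e mem_nth.
    have lt1 : 1 < sh`@r by rewrite e.
    have := sing (flatten_index sh r 1); rewrite -sumsh flatten_indexP //.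
    by rewrite flatten_indexKl // str => /(_ isT erefl); rewrite /st /flatten_index; lia.
  case/negP: nU; have hr : r < size h by rewrite size_mkseq.
  rewrite (pat_uniqv (std_pat h)) ?size_std //; apply/(uniqv_nthP hr) => r'.
  rewrite size_mkseq => r's; rewrite !nth_mkseq // => e.
  have [st'w st'r] := stP r' r's; apply/eqP/negPn/negP => nr.
  have [_ _ u] := b; have [|d dA] := u _ st'w; first by rewrite str st'r.
  by have := dA _ stw (eqxx _) => /ltd_neq; rewrite e.
- have [sp hp] := std_pat h; split.
  + by rewrite size_flatten ebs.
  + by rewrite size_std size_mkseq.
  move=> i j iw jw; rewrite ebs.
  have ri : reshape_index sh i < size sh by rewrite reshape_indexP ?sumsh.
  have rj : reshape_index sh j < size sh by rewrite reshape_indexP ?sumsh.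
  have [sti ei] := stP _ ri; have [stj ej] := stP _ rj.
  case: eqP => [ec|nc].
    rewrite !nth_flatten ebs -ec (nth_map [::]) ?size_reshape //.
    have wE k : w`@k = nth 0 (nth [::] (reshape sh w) (reshape_index sh k)) (reshape_offset sh k).
      by rewrite -[in LHS](@reshapeKr _ sh w) ?sumsh // nth_flatten reshapeKl ?sumsh.
    rewrite !wE -ec; set u := nth [::] _ _.
    have su : size u = sh`@(reshape_index sh i).
      by rewrite -(nth_map [::] 0 size) ?size_reshape // -/(shape _) reshapeKl ?sumsh.
    have [_ ->] := std_pat u; rewrite // size_std su.
      by rewrite reshape_offsetP ?sumsh.
    by rewrite ec reshape_offsetP ?sumsh.
  rewrite hp ?size_std ?size_mkseq // !nth_mkseq //.
  rewrite (cross i j (st (reshape_index sh j)) _ _ _ _ _).1 //.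
  rewrite (cross (st (reshape_index sh j)) i (st (reshape_index sh i)) _ _ _ _ _).2 //.
  by rewrite ej => /esym.
Qed.

Lemma block_ext w A B : (forall i, i < size w -> A i = B i) -> block w A -> block w B.
Proof.
move=> AB [[i iw Ai] cA uA]; split; first by exists i; rewrite -?AB.
  move=> a b c abc cw; rewrite -!AB //; try lia.
  exact: cA.
move=> j jw; rewrite -AB // => /(uA j jw)[d dA]; exists d => k kw.
by rewrite -AB //; apply: dA.
Qed.

Lemma nocut_infl w : cay w -> prim w -> 1 < size w -> (forall d k, ~ cut d w k) ->
  exists s bs, [/\ legal s bs, infl s bs w, cay s, forall u, u \in bs -> cay u
                 & simplew s /\ 2 < size s].
Proof.
move=> cw pw w1 nocut.
(* Chunks end where neighbours are not joined. As [joined] is a convex equivalence relation here,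
   the chunks are exactly its classes. *)
have [sh [sh0 sumsh hsh]] := shape_of_cuts (fun k => `[< ~ joined w k.-1 k >]) (size w).
have fibP i j : i <= j < size w ->
    reshape_index sh i = reshape_index sh j <-> joined w i j.
  move=> ijw; rewrite hsh //; split=> [H|ij k ik].
    have {}H k : i < k <= j -> joined w k.-1 k.
      by move=> /H/asboolPn/contrapT.
    case/andP: ijw; elim: j H => [|j IH] H; first by rewrite leqn0 => /eqP-> _; left.
    rewrite leq_eqVlt => /orP[/eqP->|ij] jw; first by left.
    apply: (joined_trans nocut (ltnW jw)); last by apply: (H j.+1); lia.
    by apply: IH => // [k ik|]; [apply: H; lia | lia].
  apply/asboolPn => /(_ _); apply; apply: joined_convex ij; lia.
have fibP' i j : i < size w -> j < size w ->
    reshape_index sh i = reshape_index sh j <-> joined w i j.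
  move=> iw jw; case: (leqP i j) => ij; first by apply: fibP; rewrite ij.
  by split=> [/esym|/joined_sym] /fibP; rewrite (ltnW ij) => /(_ iw) // /joined_sym.
have [|s [bs [ebs cs cbs leg iw]]] := infl_exists sh0 sumsh.
  move=> i iw; case: (joined_block nocut w1 iw) => [sing|[bi _]]; [left | right].
    by move=> j jw ej; apply: sing => //; apply/fibP'.
  apply: block_ext bi => j jw; apply/asboolP/eqP => [/joined_sym|/fibP'] H.
    exact/fibP'.
  exact/joined_sym/H.
have [szw szs _] := iw; have [_ bs0 _] := leg; subst sh.
exists s, bs; split=> //; split.
  (* A proper block of [s] pulls back to a proper block of [w], whose positions are all joined and
     hence in one chunk. *)
  move=> B bB [r rs nB] r1 r2; rewrite szs in rs * => rs1 rs2 B1 B2.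
  have [i ibs ir] := chunk_start bs0 rs.
  have [i1 ibs1 ir1] := chunk_start bs0 rs1; have [i2 ibs2 ir2] := chunk_start bs0 rs2.
  rewrite -szw in ibs ibs1 ibs2.
  rewrite -ir1 -ir2; apply/fibP' => //; right; exists (fun i => B (chunk bs i)).
  rewrite ir1 ir2; split=> //; first exact: infl_block bs0 iw bB.
  by exists i; rewrite ?ir.
have chw k : k < size w -> chunk bs k < size s by rewrite szw szs; apply: chunk_lt.
have s1 : 1 < size s.
  rewrite ltnNge; apply/negP => s1.
  have /fibP' : chunk bs 0 = chunk bs (size w).-1.
    by have := chw 0; have := chw (size w).-1; lia.
  case=> [||e|[A [[_ cA _] [k kw /negP nA] A0 An]]]; try lia.
  by apply: nA; apply: (cA 0 k (size w).-1) => //; lia.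
(* With two letters, which differ by primitivity, [w] would have a cut at the start [m] of its
   second chunk. *)
rewrite ltn_neqAle s1 andbT; apply/eqP => s2.
have [/primP ps _] := (infl_prim bs0 iw).1 pw.
have [d sd] := neq_ltd (ps 0 s1).
have ex1 : exists i, (i < size w) && (chunk bs i == 1).
  have b1 : 1 < size bs by rewrite -szs.
  by have [i ibs ir] := chunk_start bs0 b1; exists i; rewrite szw ibs ir eqxx.
case: (ex_minnP ex1) => m /andP[mw /eqP em] minm.
apply: (nocut d m); split.
  rewrite mw andbT lt0n; apply/eqP => m0.
  have b0 : 0 < size bs by rewrite -szs -s2.
  have [j jbs ej] := chunk_start bs0 b0.
  by have := leq_reshape_index (shape bs) (leq0n j); rewrite ej; rewrite m0 in em; rewrite em.
move=> i j im /andP[mj jw]; have ilt := ltn_trans im mw.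
have ei : chunk bs i = 0.
  have := chw i ilt; have := minm i; rewrite ilt -s2 => H.
  have : chunk bs i <> 1 by move=> e; move: H; rewrite e eqxx => /(_ isT); lia.
  by lia.
have ej : chunk bs j = 1.
  by have := chw j jw; have := leq_reshape_index (shape bs) mj; rewrite em -s2; lia.
by rewrite (infl_ltd d iw) ?ei ?ej.
Qed.

(** * Words with a cut *)

Definition indec d w : bool := `[< forall k, ~ cut d w k >].

(* [duo true] and [duo false] are the words 12 and 21: direct and skew sums are
   the inflations of these two words. *)
Definition duo (d : bool) : seq nat := if d then [:: 0; 1] else [:: 1; 0].

Lemma duo_cay d : cay (duo d).
Proof. by case: d. Qed.

Lemma duo_uniqv d r : r < 2 -> uniqv (duo d) (duo d)`@r.
Proof. by case: d; case: r => [|[]]. Qed.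

Lemma size_duo d : size (duo d) = 2.
Proof. by case: d. Qed.

Lemma legal_duo d u v : 0 < size u -> 0 < size v -> legal (duo d) [:: u; v].
Proof.
move=> u0 v0; split; rewrite ?size_duo //.
  by rewrite !inE; lia.
by move=> r r2; rewrite duo_uniqv.
Qed.

Lemma infl_duo d u v w : infl (duo d) [:: u; v] w ->
  size w = size u + size v /\
  forall i j, i < size w -> j < size w ->
    (w`@i < w`@j) = if (i < size u) == (j < size u)
                    then (u ++ v)`@i < (u ++ v)`@j
                    else (i < size u) == d.
Proof.
case=> /=; rewrite cats0 size_cat => sw _ h; split=> // i j iw jw.
rewrite h // !reshape_index_cons.
have v1 k : k < size w -> size u <= k -> (k - size u < size v) by lia.
case: (ltnP i (size u)) => iu; case: (ltnP j (size u)) => ju;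
  rewrite ?eqxx ?v1 //=; by case: d {h}.
Qed.

Lemma infl_duo_cut d u v w : 0 < size u -> 0 < size v ->
  infl (duo d) [:: u; v] w -> cut d w (size u).
Proof.
move=> u0 v0 /infl_duo[sw h].
split=> [|i j iu /andP[uj jw]]; first by lia.
have iw : i < size w by lia.
have ju : (j < size u) = false by lia.
by case: d h => h /=; rewrite h // iu ju.
Qed.

Lemma infl_duo_cut_left d u v w k : infl (duo d) [:: u; v] w ->
  k < size u -> cut d w k -> cut d u k.
Proof.
move=> /infl_duo[sw h] ku [/andP[k0 kw] c]; split=> [|i j ik /andP[kj ju]].
  by rewrite k0.
have iu : i < size u by lia.
have := c i j ik; rewrite kj sw ltn_addr //= => /(_ isT).
by case: d {c} h => h /=; rewrite h ?sw ?ltn_addr // iu ju eqxx !nth_cat iu ju.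
Qed.

(** If the first summands had different lengths, the end of the shorter one would cut the longer
    one, which is indecomposable. *)
Lemma infl_duo_inj d u v u' v' w :
  infl (duo d) [:: u; v] w -> infl (duo d) [:: u'; v'] w ->
  0 < size u -> 0 < size v -> 0 < size u' -> 0 < size v' ->
  cay u -> cay v -> cay u' -> cay v' -> indec d u -> indec d u' ->
  u = u' /\ v = v'.
Proof.
move=> iw iw' u0 v0 u'0 v'0 cu cv cu' cv' /asboolP iu /asboolP iu'.
have su : size u = size u'.
  case: (ltngtP (size u) (size u')) => // lt.
    by case: (iu' (size u)); apply: (infl_duo_cut_left iw') (infl_duo_cut u0 v0 iw).
  by case: (iu (size u')); apply: (infl_duo_cut_left iw) (infl_duo_cut u'0 v'0 iw').
have [sw _] := infl_duo iw; have [sw' _] := infl_duo iw'.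
have [_ bs0 _] := legal_duo d u0 v0.
have [|||||_ [-> ->] //] := infl_inj iw iw' _ bs0.
- by rewrite /= su; congr [:: _; _]; lia.
- exact: duo_cay.
- exact: duo_cay.
- by move=> x; rewrite !inE => /orP[] /eqP->.
- by move=> x; rewrite !inE => /orP[] /eqP->.
Qed.

Lemma cut_infl d w : cay w -> ~~ indec d w ->
  exists u v, [/\ 0 < size u, 0 < size v, cay u, cay v & indec d u /\ infl (duo d) [:: u; v] w].
Proof.
move=> cw /asboolPn/existsNP[k0 /contrapT ck0].
(* The least cut is taken: a cut of the first summand would be a smaller cut of [w], so that summand
   is indecomposable. *)
have ex : exists k, `[< cut d w k >] by exists k0; apply/asboolP.
case: (ex_minnP ex) => m /asboolP cm minm {k0 ck0 ex}.
have [/andP[m0 mw] c] := cm; have [b1 b2 _ _] := cut_blocks cm.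
have sh0 : 0 \notin [:: m; size w - m] by rewrite !inE; lia.
have sumsh : sumn [:: m; size w - m] = size w by rewrite /= addn0 subnKC // ltnW.
have riE i : i < size w -> reshape_index [:: m; size w - m] i = (m <= i).
  move=> iw; rewrite !reshape_index_cons; case: ltnP => // mi.
  by rewrite ltn_sub2r.
have [|s [bs [ebs cs cbs leg iw]]] := infl_exists sh0 sumsh.
  move=> i iw; right; case: (ltnP i m) => im.
    by apply: block_ext b1 => j jw; rewrite !riE // [m <= i]leqNgt im; case: leqP.
  by apply: block_ext b2 => j jw; rewrite !riE // im; case: leqP.
case: bs ebs cbs leg iw => [|u [|v []]] //= [su sv] cbs leg iw.
have u0 : 0 < size u by rewrite su.
have v0 : 0 < size v by rewrite sv subn_gt0.
have [_ ss h] := iw.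
have es : s = duo d.
  apply: cay_pat_inj cs (duo_cay d) _; split=> [|i j]; rewrite ss ?size_duo //.
  have := infl_ltd d iw (ltn_trans m0 mw) mw.
  rewrite !reshape_index_cons su sv m0 ltnn subnn subn_gt0 mw c ?leqnn //=.
  move=> /(_ ltac:(by []))/esym.
  by case: i => [|[|]] //; case: j => [|[|]] //; case: (d) => /=; rewrite ?ltnn //; lia.
rewrite {}es in iw.
exists u, v; split=> //; try by apply: cbs; rewrite !inE eqxx ?orbT.
split=> //; apply/asboolP => k ck; have [/andP[k0 ku] cku] := ck.
have := minm k; rewrite -su [in X in X -> _]leqNgt ku.
have -> : `[< cut d w k >]; last by move=> /(_ isT).
have [sw hw] := infl_duo iw.
apply/asboolP; split=> [|i j ik /andP[kj jw]]; first by rewrite k0; lia.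
case: (ltnP j (size u)) => ju; last by apply: c; lia.
have := cku i j ik; rewrite kj => /(_ ju); have iu := ltn_trans ik ku.
case: d {ck c cku minm cm h iw} hw => hw /=;
  by rewrite hw ?sw ?ltn_addr // iu ju eqxx !nth_cat iu ju.
Qed.

Lemma infl_duo_prim d u v w : 0 < size u -> 0 < size v ->
  infl (duo d) [:: u; v] w -> prim w = prim u && prim v.
Proof.
move=> u0 v0 iw; have [_ bs0 _] := legal_duo d u0 v0.
apply/idP/andP => [/(infl_prim bs0 iw)[_ p]|[pu pv]].
  by rewrite !p // !inE eqxx ?orbT.
apply/(infl_prim bs0 iw); split=> [|x]; first by case: d {iw bs0}.
by rewrite !inE => /orP[] /eqP->.
Qed.

Lemma infl_duo_nuniq d u v w : 0 < size u -> 0 < size v ->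
  infl (duo d) [:: u; v] w -> nuniq w = nuniq u + nuniq v.
Proof.
move=> u0 v0 iw; have [_ bs0 _] := legal_duo d u0 v0.
by rewrite (infl_nuniq bs0 iw) /= !duo_uniqv // addn0.
Qed.

(** * Words as lists *)

Definition word_of n (f : {ffun 'I_n -> 'I_n}) : seq nat := [seq val (f i) | i <- enum 'I_n].

Definition words n : seq (seq nat) := [seq word_of f | f : {ffun 'I_n -> 'I_n}].

Lemma size_word_of n (f : {ffun 'I_n -> 'I_n}) : size (word_of f) = n.
Proof. by rewrite size_map size_enum_ord. Qed.

Lemma nth_word_of n (f : {ffun 'I_n -> 'I_n}) (i : 'I_n) : (word_of f)`@i = f i.
Proof. by rewrite (nth_map i) ?size_enum_ord // nth_ord_enum. Qed.

Lemma mem_word_of n (f : {ffun 'I_n -> 'I_n}) (x : nat) :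
  reflect (exists i, x = val (f i)) (x \in word_of f).
Proof.
apply: (iffP mapP) => [[i _ ->]|[i ->]]; first by exists i.
by exists i; rewrite // mem_enum.
Qed.

Lemma word_of_inj n : injective (@word_of n).
Proof.
by move=> f g e; apply/ffunP => i; apply: val_inj; rewrite /= -!nth_word_of e.
Qed.

Lemma words_uniq n : uniq (words n).
Proof. by rewrite map_inj_uniq ?enum_uniq //; apply: word_of_inj. Qed.

Lemma mem_words n u : (u \in words n) = (size u == n) && all (fun x => x < n) u.
Proof.
apply/mapP/andP => [[f _ ->]|[/eqP su /allP un]].
  by rewrite size_word_of; split=> //; apply/allP => x /mem_word_of[i ->]; apply: ltn_ord.
have ux (i : 'I_n) : u`@i < n by apply: un; rewrite mem_nth ?su.
exists [ffun i => Ordinal (ux i)]; first by rewrite mem_enum.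
apply: (@eq_from_nth _ 0) => [|i iu]; first by rewrite size_word_of.
by rewrite su in iu; rewrite -[i]/(val (Ordinal iu)) nth_word_of ffunE.
Qed.

Lemma cay_words u : cay u -> u \in words (size u).
Proof. by move=> cu; rewrite mem_words eqxx; apply/allP => x /(cay_lt cu). Qed.

Section Word.
Variables (n : nat) (f : {ffun 'I_n -> 'I_n}).
Local Notation w := (word_of f).

Lemma cayleyE : cayley f = cay w.
Proof.
apply/existsP/cayP => [[m /eqP im] x y /mem_word_of[i ->] ltx|cw].
  have : f i \in f @: setT by rewrite imset_f.
  rewrite im inE => fm; have xn : x < n by apply: ltn_trans (ltn_ord (f i)).
  have : Ordinal xn \in f @: setT by rewrite im inE /= (ltn_trans ltx).
  by case/imsetP => j _ e; apply/mem_word_of; exists j; rewrite -e.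
have nw : n \notin w by apply/mem_word_of => -[i e]; have := ltn_ord (f i); rewrite -e ltnn.
have ex : exists k, k \notin w by exists n.
case: (ex_minnP ex) => m mw minm.
have mn : m < n.+1 by rewrite ltnS minm.
exists (Ordinal mn); apply/eqP/setP => j; rewrite inE /=; apply/imsetP/idP => [[i _ ->]|jm].
  rewrite ltnNge leq_eqVlt; apply: contra mw => /orP[/eqP->|mf].
    by apply/mem_word_of; exists i.
  by apply: cw mf; apply/mem_word_of; exists i.
have : val j \in w by apply: contraLR jm => /minm; rewrite -leqNgt.
by case/mem_word_of => i /val_inj->; exists i.
Qed.

(** [mu] counts values and [nuniq] counts positions; [f] is injective on the positions whose value
    occurs once. *)
Lemma muE : mu f = nuniq w.
Proof.
have cm (j : 'I_n) : #|f @^-1: [set j]| = count_mem (val j) w.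
  rewrite count_map cardE size_filter enumT; apply: eq_count => i.
  by rewrite !inE.
rewrite /nuniq count_map -size_filter enumT /mu.
have -> : [set j | #|f @^-1: [set j]| == 1] =
          f @: [set i | uniqv w (f i)].
  apply/setP => j; rewrite inE; apply/idP/imsetP => [/cards1P[i e]|[i]].
    have : i \in f @^-1: [set j] by rewrite e inE.
    rewrite !inE => /eqP ei; exists i => //; rewrite inE /uniqv ei -cm e cards1.
    by [].
  by rewrite inE /uniqv -cm => + ->.
rewrite card_in_imset; last first.
  move=> i j; rewrite !inE /uniqv -!cm => /cards1P[k e] _ ef.
  have : i \in f @^-1: [set f i] by rewrite !inE.
  have : j \in f @^-1: [set f i] by rewrite !inE ef.
  by rewrite e !inE => /eqP-> /eqP->.
by rewrite cardE; congr size; apply: eq_filter => i; rewrite [LHS]inE.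
Qed.

Lemma primitiveE : primitive f = prim w.
Proof.
apply/forallP/primP => [h i|h i]; rewrite ?size_word_of.
  move=> ltin; have := forallP (h (Ordinal (ltnW ltin))) (Ordinal ltin).
  by rewrite /= eqxx /= -!val_eqE /= -!nth_word_of.
apply/forallP => j; apply/implyP => /eqP ej.
have := h i; rewrite size_word_of -ej ltn_ord => /(_ isT).
by rewrite !nth_word_of.
Qed.

Lemma is_itvP (I : {set 'I_n}) :
  reflect (I != set0 /\ forall i j k : 'I_n, i <= j <= k -> i \in I -> k \in I -> j \in I)
          (is_itv I).
Proof.
apply: (iffP existsP) => [[a /existsP[b /andP[ab /eqP->]]]|[/set0Pn[i0 Ii0] cvx]].
  split; first by apply/set0Pn; exists a; rewrite inE leqnn.
  by move=> i j k; rewrite !inE; lia.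
case: (arg_minnP val Ii0) => a Ia mina; case: (arg_maxnP val Ii0) => b Ib maxb.
exists a; apply/existsP; exists b; rewrite mina //=; apply/eqP/setP => i.
rewrite inE; apply/idP/idP => [Ii|iab]; last exact: cvx iab Ia Ib.
by rewrite mina //=; apply: maxb.
Qed.

(** For a block take [J] to be its image. This is an interval because in a Cayley word each
    intermediate value occurs; at a position outside the block it would lie on one side of the whole
    block, not between two of its values. Conversely, a value outside the interval [J] lies on one
    side of it. *)
Lemma simpleE : cayley f -> simple f = `[< simplew w >].
Proof.
rewrite cayleyE => /cayP cw; apply/forallP/asboolP => [sf A bA nA i j|sw I].
- rewrite size_word_of => iltn jltn Ai Aj.
  have [[i0 i0w Ai0] cA uA] := bA; rewrite size_word_of in i0w cA uA.
  pose I := [set i : 'I_n | A i].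
  have itvI : is_itv I.
    apply/is_itvP; split; first by apply/set0Pn; exists (Ordinal i0w); rewrite inE.
    by move=> a b c abc; rewrite !inE; apply: cA.
  have HI : H_interval f I.
    rewrite /H_interval itvI; apply/existsP; exists (f @: I); rewrite eqxx /=.
    have fI k : (f k \in f @: I) = A k.
      apply/imsetP/idP => [[l]|Ak]; last by exists k; rewrite ?inE.
      rewrite inE => Al e; apply/negPn/negP => nAk; have [d dA] := uA k (ltn_ord k) nAk.
      by apply: (ltd_neq (dA l (ltn_ord l) Al)); rewrite !nth_word_of e.
    apply/andP; split; last by apply/eqP/setP => k; rewrite inE fI inE.
    apply/is_itvP; split.
      by apply/set0Pn; exists (f (Ordinal i0w)); rewrite fI.
    move=> a b c /andP[ab bc] /imsetP[ia + ea] /imsetP[ic + ec]; rewrite !inE => Aa Ac.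
    have : (b : nat) \in w.
      move: bc; rewrite leq_eqVlt => /orP[/eqP->|].
        by apply/mem_word_of; exists ic; rewrite ec.
      by apply: cw; apply/mem_word_of; exists ic; rewrite ec.
    case/mem_word_of => k /val_inj ek; rewrite ek fI; apply/negPn/negP => nAk.
    have [d dA] := uA k (ltn_ord k) nAk.
    have := dA ia (ltn_ord ia) Aa; have := dA ic (ltn_ord ic) Ac.
    by rewrite !nth_word_of -ek -ea -ec; case: d {dA} => /=; lia.
  have /implyP/(_ HI)/orP[/cards1P[k e]|/eqP e] := sf I.
    have : Ordinal iltn \in I by rewrite inE.
    have : Ordinal jltn \in I by rewrite inE.
    by rewrite e !inE => /eqP <- /eqP [].
  have [k] := nA; rewrite size_word_of => kn.
  have : Ordinal kn \in I by rewrite e inE.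
  by rewrite inE => /= Ak; rewrite Ak.
- apply/implyP => /andP[/is_itvP[I0 cI] /existsP[J /and3P[/is_itvP[_ cJ] /eqP eJ /eqP eI]]].
  pose A := fun i => [exists j in I, val j == i].
  have AE (i : 'I_n) : A i = (i \in I).
    apply/existsP/idP => [[j /andP[Ij /eqP/val_inj <-]]//|Ii].
    by exists i; rewrite Ii eqxx.
  have bA : block w A.
    split; rewrite ?size_word_of.
    - by case/set0Pn: I0 => i Ii; exists i; rewrite ?AE.
    - move=> i j k ijk kn; have jn : j < n by lia.
      have iltn : i < n by lia.
      rewrite -[i]/(val (Ordinal iltn)) -[j]/(val (Ordinal jn)) -[k]/(val (Ordinal kn)) !AE.
      exact: cI.
    - move=> i iltn; rewrite -[i]/(val (Ordinal iltn)) AE; move: (Ordinal iltn) => {iltn}i.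
      rewrite -eI inE => nJ; case/set0Pn: I0 => k0 Ik0.
      have JI k : k \in I -> f k \in J by rewrite -eI inE.
      exists (f i < f k0) => j jn; rewrite -[j]/(val (Ordinal jn)) AE !nth_word_of.
      move/JI; move: (f (Ordinal jn)) (f k0) (JI _ Ik0) => y y0 Jy0 Jy.
      have ney : val y <> val (f i) by move/val_inj => e; rewrite -e Jy in nJ.
      have ney0 : val y0 <> val (f i) by move/val_inj => e; rewrite -e Jy0 in nJ.
      case: ltnP => /= h.
        case: (ltnP (f i) y) => // yi; case/negP: nJ; apply: (cJ y (f i) y0) => //; lia.
      case: (ltnP y (f i)) => // yi; case/negP: nJ; apply: (cJ y0 (f i) y) => //; lia.
  have [nA|fA] := pselect (nonfull w A).
    apply/orP; left; case/set0Pn: I0 => i Ii; apply/cards1P; exists i; apply/setP => j.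
    rewrite inE; apply/idP/eqP => [Ij|->//]; apply: val_inj.
    by apply: (sw A bA nA); rewrite ?size_word_of ?[A _]AE //; apply: ltn_ord.
  apply/orP; right; apply/eqP/setP => i; rewrite in_setT -AE.
  have [//|nAi] := boolP (A i); case: fA; exists (val i) => //.
  by rewrite size_word_of; apply: ltn_ord.
Qed.

End Word.

Lemma card_words n (p : pred (seq nat)) :
  #|[set f : {ffun 'I_n -> 'I_n} | p (word_of f)]| = count p (words n).
Proof.
rewrite /words count_map cardE size_filter -enumT.
by apply: eq_count => f; rewrite [LHS]inE.
Qed.

(** * Generating functions of classes of words *)

Definition words_le n : seq (seq nat) := [seq u | m <- iota 0 n.+1, u <- words m].

Lemma mem_words_le n u : (u \in words_le n) = (size u <= n) && (u \in words (size u)).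
Proof.
apply/allpairsPdep/andP => [[m [v [+ vm ->]]]|[un uw]].
  rewrite mem_iota add0n ltnS => /= mn; move: (vm); rewrite mem_words => /andP[/eqP e _].
  by rewrite e.
by exists (size u), u; rewrite mem_iota.
Qed.

Lemma words_le_uniq n : uniq (words_le n).
Proof.
apply: allpairs_uniq_dep => [|m _|]; rewrite ?iota_uniq ?words_uniq //.
move=> p q /allpairsPdep[m [u [_ + ->]]] /allpairsPdep[m' [u' [_ + ->]]] /= e.
by subst u'; rewrite !mem_words => /andP[/eqP <- _] /andP[/eqP <- _].
Qed.

(** A class of words together with the statistic that becomes the exponent of [t]. *)
Definition wclass := (pred (seq nat) * (seq nat -> nat))%type.

(** The tuples of total length [n], one word from each class: the terms of the coefficient of index
    [n] in the product of the series of the classes. *)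
Fixpoint tuples_of (K : seq wclass) n : seq (seq (seq nat)) :=
  if K is k :: K' then
    [seq u :: us | u <- [seq u <- words_le n | k.1 u], us <- tuples_of K' (n - size u)]
  else if n == 0 then [:: [::]] else [::].

Definition weight (K : seq wclass) us : nat := sumn [seq p.1.2 p.2 | p <- zip K us].

Lemma mem_tuples_of K n us : (us \in tuples_of K n) =
  (sumn (shape us) == n) && all2 (fun (k : wclass) u => k.1 u && (u \in words (size u))) K us.
Proof.
elim: K n us => [|k K IH] n us.
  by case: us => [|u us]; rewrite /= ?andbF; case: n.
apply/allpairsPdep/andP => [[u [vs [+ + ->]]]|].
  rewrite mem_filter mem_words_le IH => /and3P[ku un uw] /andP[/eqP sv av] /=.
  by rewrite ku uw av sv subnKC.
case: us => [[]//|u us] /= [/eqP <- /andP[/andP[ku uw] au]].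
exists u, us; split=> //; first by rewrite mem_filter ku mem_words_le leq_addr.
by rewrite IH addKn eqxx.
Qed.

Lemma tuples_of_uniq K n : uniq (tuples_of K n).
Proof.
elim: K n => [|k K IH] n /=; first by case: n.
apply: allpairs_uniq_dep => [|u _|]; rewrite ?IH ?filter_uniq ?words_le_uniq //.
by move=> [u us] [v vs] _ _ /= [-> ->].
Qed.

Import GRing.Theory.
Local Open Scope ring_scope.

Lemma big_bij_seq (R : nmodType) (I J : eqType) (s : seq I) (t : seq J)
    (f : I -> J) (F : J -> R) :
  uniq s -> uniq t -> {in s &, injective f} -> {in s, forall x, f x \in t} ->
  {in t, forall y, exists2 x, x \in s & y = f x} ->
  \sum_(y <- t) F y = \sum_(x <- s) F (f x).
Proof.
move=> us ut inj st ts; rewrite -(big_map f xpredT); apply: perm_big.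
apply: uniq_perm => // [|y]; first by rewrite map_inj_in_uniq.
by apply/idP/mapP => [/ts|[x /st fx ->]].
Qed.

Definition gf (k : wclass) : fps {poly int} :=
  Fps (fun n => \sum_(u <- words n | k.1 u) 'X^(k.2 u)).

Lemma sum_words_le (R : nmodType) (p : pred (seq nat)) (F : seq nat -> R) n :
  \sum_(u <- words_le n | p u) F u = \sum_(m < n.+1) \sum_(u <- words m | p u) F u.
Proof.
rewrite big_mkcond big_allpairs_dep /=.
rewrite -(big_mkord xpredT (fun m => \sum_(u <- words m | p u) F u)).
by rewrite /index_iota subn0; apply: eq_bigr => m _; rewrite [RHS]big_mkcond.
Qed.

Lemma sum_tuples_of K n :
  \sum_(us <- tuples_of K n) 'X^(weight K us) = (\prod_(k <- K) gf k) n.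
Proof.
elim: K n => [|k K IH] n /=.
  by rewrite big_nil fps1; case: n => [|n]; rewrite ?big_nil ?big_seq1.
rewrite big_allpairs_dep big_filter sum_words_le big_cons fpsM; apply: eq_bigr => m _ /=.
rewrite mulr_suml big_seq_cond [RHS]big_seq_cond; apply: eq_bigr => u /andP[um ku].
have -> : size u = m by move: um; rewrite mem_words => /andP[/eqP].
by rewrite -IH mulr_sumr; apply: eq_bigr => us _; rewrite /weight /= exprD.
Qed.

Definition pcay u : bool := [&& 0 < size u, cay u & prim u]%N.

(* The letters of a simple word are inflated by words of class [kprim] if they
   are unique and [kletter] if they are repeated; the latter do not contribute
   any unique value, whence the weight 0. *)
Definition kprim : wclass := (pcay, nuniq).
Definition kletter : wclass := (fun u => u == [:: 0%N], fun=> 0%N).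

Lemma P_gf : P = gf kprim.
Proof.
apply: fpsP => n /=; rewrite /words big_map big_enum_cond /=.
by apply: eq_big => f; rewrite /pcay cayleyE primitiveE ?muE ?size_word_of.
Qed.

Lemma X_gf : fps_X = gf kletter.
Proof.
apply: fpsP => n /=; have [->|n1] := eqVneq n 1%N.
  rewrite (eq_bigl (pred1 [:: 0%N])) // -big_filter.
  by rewrite filter_pred1_uniq ?words_uniq ?big_seq1 ?mem_words.
rewrite big_seq_cond big1 // => u /andP[+ /eqP e].
by rewrite e mem_words /= eq_sym (negPf n1).
Qed.

Lemma fps_mulX (R : comNzRingType) (f : fps R) k n :
  (f * fps_X ^+ k) n = if (k <= n)%N then f (n - k)%N else 0.
Proof.
elim: k n => [|k IH] n; first by rewrite expr0 mulr1 subn0.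
have mulX (g : fps R) m : (g * fps_X) m = if m is m'.+1 then g m' else 0.
  rewrite mulrC fpsM; case: m => [|m]; first by rewrite big_ord1 mul0r.
  rewrite big_ord_recl /= mul0r add0r big_ord_recl /= mul1r subSS subn0 big1 ?addr0 // => i _.
  by rewrite mul0r.
by rewrite exprSr mulrA mulX; case: n => // n; rewrite IH.
Qed.

Lemma P0 : P 0%N = 0.
Proof. by rewrite /= big_pred0. Qed.

(** A decomposable word corresponds to the pair of its first indecomposable summand and the
    arbitrary nonempty rest. *)
Lemma cut_sum d n :
  \sum_(w <- words n | pcay w && ~~ indec d w) 'X^(nuniq w)
  = (gf (fun u => pcay u && indec d u, nuniq) * P) n :> {poly int}.
Proof.
set kI : wclass := (_, _); rewrite P_gf -big_filter.
have -> : gf kI * gf kprim = \prod_(k <- [:: kI; kprim]) gf k.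
  by rewrite !big_cons big_nil mulr1.
rewrite -sum_tuples_of.
have inP us : us \in tuples_of [:: kI; kprim] n -> exists u v,
    [/\ us = [:: u; v], (size u + size v)%N = n, pcay u, pcay v & indec d u].
  rewrite mem_tuples_of; case: us => [|u [|v [|x us]]] /=; rewrite ?andbF // addn0 andbT.
  by case/and3P => /eqP suv /andP[/andP[pu iu] _] /andP[pv _]; exists u, v.
have inf us : us \in tuples_of [:: kI; kprim] n -> infl (duo d) us (inflate (duo d) us).
  by case/inP => u [v [-> _ /and3P[u0 _ _] /and3P[v0 _ _] _]]; apply/inflateP/legal_duo.
rewrite (@big_bij_seq _ _ _ (tuples_of [:: kI; kprim] n) _ (inflate (duo d))).
- rewrite !big_seq; apply: eq_bigr => us us_in; have iw := inf us us_in.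
  case/inP: us_in iw => u [v [-> _ /and3P[u0 _ _] /and3P[v0 _ _] _]] iw.
  by rewrite (infl_duo_nuniq u0 v0 iw) /weight /= addn0.
- exact: tuples_of_uniq.
- by rewrite filter_uniq ?words_uniq.
- move=> us us' us_in us'_in e; have := inf us us_in; have := inf us' us'_in; rewrite -e.
  case/inP: us_in => u [v [-> _ /and3P[u0 cu _] /and3P[v0 cv _] iu]].
  case/inP: us'_in => u' [v' [-> _ /and3P[u'0 cu' _] /and3P[v'0 cv' _] iu']] iw' iw.
  by have [-> ->] := infl_duo_inj iw iw' u0 v0 u'0 v'0 cu cv cu' cv' iu iu'.
- move=> us us_in; have iw := inf us us_in; have cw := inflate_cay (duo d) us.
  case/inP: us_in cw iw => u [v [-> suv /and3P[u0 cu pu] /and3P[v0 cv pv] iu]] cw iw.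
  have [sw _] := infl_duo iw.
  rewrite mem_filter -[n in words n]suv -sw cay_words // /pcay cw sw (infl_duo_prim u0 v0 iw) pu pv.
  rewrite addn_gt0 u0 /= andbT; apply/negP => /asboolP; apply.
  exact: infl_duo_cut iw.
- move=> w; rewrite mem_filter => /andP[/andP[/and3P[w0 cw pw] dw] wn].
  have [u [v [u0 v0 cu cv [iu iw]]]] := cut_infl cw dw.
  have [sw _] := infl_duo iw; move: wn; rewrite mem_words => /andP[/eqP sn _].
  have := infl_duo_prim u0 v0 iw; rewrite pw => /esym/andP[pu pv].
  exists [:: u; v]; last by apply: infl_cay => //; apply: legal_duo.
  by rewrite mem_tuples_of /= addn0 -sw sn eqxx /pcay u0 v0 cu cv pu pv iu !cay_words.
Qed.

Lemma leq_size_sumn sh : 0%N \notin sh -> (size sh <= sumn sh)%N.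
Proof. by elim: sh => //= a sh IH; rewrite inE negb_or => /andP[a0 /IH]; lia. Qed.

(** * Inflations of simple words as tuples *)

Definition big_simple s : bool := [&& 2 < size s, cay s, prim s & `[< simplew s >]]%N.

Definition slots s : seq wclass := [seq if uniqv s x then kprim else kletter | x <- s].

Lemma gf_slots s :
  \prod_(k <- slots s) gf k = P ^+ nuniq s * fps_X ^+ (size s - nuniq s).
Proof.
rewrite big_map /nuniq; move: (uniqv s) => p; elim: s => [|x s IH].
  by rewrite big_nil !expr0 mulr1.
rewrite big_cons {}IH /=; case: (p x).
  by rewrite -P_gf add1n subSS exprS mulrA.
by rewrite -X_gf add0n subSn ?count_size // exprS mulrCA.
Qed.

Lemma slotsP n s bs : bs \in tuples_of (slots s) n <->
  [/\ size (flatten bs) = n, legal s bs & forall u, u \in bs -> cay u && prim u].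
Proof.
rewrite mem_tuples_of all2E size_map -size_flatten.
have nth_slots r : (r < size s)%N ->
    nth kprim (slots s) r = if uniqv s s`@r then kprim else kletter.
  by move=> rs; rewrite (nth_map 0%N).
split=> [/and3P[/eqP <- /eqP sz /(all_nthP (kprim, [::])) h]|].
  have {}h r : (r < size bs)%N -> let u := nth [::] bs r in
      [&& (0 < size u)%N, cay u & prim u] /\ (~~ uniqv s s`@r -> u = [:: 0%N]).
    move=> rbs; have := h r; rewrite size_zip size_map sz minnn rbs => /(_ isT).
    rewrite /= nth_zip ?size_map // nth_slots ?sz //=.
    by case: uniqv => /= /andP[]// /eqP->.
  split=> //.
    split=> // [|r rs]; last by apply: (h r _).2; rewrite -sz.
    by apply/negP => /mapP[u /(nthP [::])[r /h[/and3P[+ _ _] _] <-] e]; rewrite -e.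
  by move=> u /(nthP [::])[r /h[/and3P[_ cu pu] _] <-]; rewrite cu pu.
move=> [<- [sz bs0 leg] cp]; rewrite eqxx sz eqxx /=.
apply/(all_nthP (kprim, [::])) => r; rewrite size_zip size_map sz minnn => rbs.
rewrite /= nth_zip ?size_map //= nth_slots ?sz //.
have /andP[cu pu] := cp _ (mem_nth [::] rbs); rewrite cay_words // andbT.
have u0 : (0 < size (nth [::] bs r))%N.
  rewrite lt0n; apply: contraNneq bs0 => <-.
  by rewrite -(nth_map [::] 0%N size) // mem_nth ?size_map.
case: ifPn => [_|nU]; first by rewrite /= /pcay u0 cu pu.
by rewrite /= leg ?sz.
Qed.

Lemma weight_slots s bs w : legal s bs -> infl s bs w -> weight (slots s) bs = nuniq w.
Proof.
move=> [sz bs0 _] iw; rewrite (infl_nuniq bs0 iw) /weight; congr sumn.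
apply: (@eq_from_nth _ 0%N) => [|r].
  by rewrite size_map size_zip !size_map sz minnn size_iota.
rewrite size_map size_zip size_map sz minnn => rbs.
rewrite (nth_map (kprim, [::])) ?size_zip ?size_map ?sz ?minnn //.
rewrite nth_mkseq // nth_zip ?size_map //= (nth_map 0%N) ?sz //.
by case: uniqv.
Qed.

(** By [infl_joined] the chunks of either decomposition are the classes of [joined w], which depends
    on [w] alone; so the shapes agree and [infl_inj] applies. *)
Lemma infl_simple_inj s bs s' bs' w : legal s bs -> legal s' bs' ->
  infl s bs w -> infl s' bs' w -> big_simple s -> big_simple s' ->
  (forall u, u \in bs -> cay u) -> (forall u, u \in bs' -> cay u) ->
  s = s' /\ bs = bs'.
Proof.
move=> leg leg' iw iw' /and4P[s3 cs _ /asboolP sim] /and4P[s'3 cs' _ /asboolP sim'] cbs cbs'.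
have [_ bs0 _] := leg; have [_ bs'0 _] := leg'; have [sw _ _] := iw; have [sw' _ _] := iw'.
apply: (infl_inj iw iw') => //; apply: reshape_index_inj => //.
  by rewrite -!size_flatten -sw sw'.
move=> i j; rewrite -size_flatten -sw => /andP[ij jw].
have iltw := ltn_trans ij jw.
apply/eqP/eqP => e; first by apply/(infl_joined leg' iw') => //; apply/(infl_joined leg iw).
by apply/(infl_joined leg iw) => //; apply/(infl_joined leg' iw').
Qed.

(** The words without cuts correspond to the pairs of a simple word and a tuple of blocks. No chunk
    is empty, so a simple word of length at most [n] is always found. *)
Lemma simple_sum n :
  \sum_(w <- words n | [&& pcay w, (1 < n)%N, indec true w & indec false w]) 'X^(nuniq w)
  = \sum_(s <- words_le n | big_simple s) (P ^+ nuniq s * fps_X ^+ (size s - nuniq s)) n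
  :> {poly int}.
Proof.
under [RHS]eq_bigr do rewrite -gf_slots -sum_tuples_of.
rewrite -[RHS]big_filter -[LHS]big_filter.
set S := filter _ (words_le n); set T := filter _ (words n).
pose L := [seq (s, bs) | s <- S, bs <- tuples_of (slots s) n].
transitivity (\sum_(p <- L) 'X^(weight (slots p.1) p.2) : {poly int}); last first.
  by rewrite big_allpairs_dep.
have LP s bs : (s, bs) \in L -> [/\ big_simple s, size (flatten bs) = n, legal s bs,
    infl s bs (inflate s bs) & forall u, u \in bs -> cay u && prim u].
  case/allpairsPdep => s' [bs' [+ /slotsP[sn leg cp] [-> ->]]].
  by rewrite mem_filter => /andP[ss _]; split=> //; apply: inflateP.
rewrite (@big_bij_seq _ _ _ L T (fun p => inflate p.1 p.2)).
- rewrite !big_seq; apply: eq_bigr => -[s bs] /LP[_ _ leg iw _] /=.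
  by rewrite (weight_slots leg iw).
- apply: allpairs_uniq_dep => [|s _|]; rewrite ?filter_uniq ?words_le_uniq ?tuples_of_uniq //.
  by move=> [s bs] [s' bs'] _ _ /= [-> ->].
- by rewrite filter_uniq ?words_uniq.
- move=> [s bs] [s' bs'] /LP[ss _ leg iw cp] /LP[ss' _ leg' iw' cp'] /= e.
  rewrite -e in iw'; have [||-> -> //] := infl_simple_inj leg leg' iw iw' ss ss'.
    by move=> u /cp/andP[].
  by move=> u /cp'/andP[].
- move=> [s bs] /LP[/and4P[s3 cs ps /asboolP sim] sn leg iw cp] /=.
  have [sz bs0 _] := leg; have [sw _ _] := iw; have cw := inflate_cay s bs.
  have := leq_size_sumn bs0; rewrite -size_flatten sn size_map -sz => sn'.
  rewrite mem_filter -[n in words n]sn -sw cay_words // andbT /pcay cw sw sn.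
  have -> : prim (inflate s bs).
    by apply/(infl_prim bs0 iw); split=> // u /cp/andP[].
  have nc d : indec d (inflate s bs).
    by apply/asboolP => k; apply: infl_nocut iw sim s3.
  by rewrite !nc !andbT /=; apply/andP; split; lia.
- move=> w; rewrite mem_filter => /andP[/and4P[/and3P[w0 cw pw] n1 it if_] wn].
  move: (wn); rewrite mem_words => /andP[/eqP sn _].
  have nocut d k : ~ cut d w k.
    by case: d; [move/asboolP: it; apply | move/asboolP: if_; apply].
  rewrite -sn in n1; have [s [bs [leg iw cs cbs [sim s3]]]] := nocut_infl cw pw n1 nocut.
  have [sz bs0 _] := leg; have [sw _ _] := iw.
  have [ps pbs] := (infl_prim bs0 iw).1 pw.
  have := leq_size_sumn bs0; rewrite -size_flatten -sw sn size_map -sz => sn'.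
  exists (s, bs); last exact: infl_cay.
  apply/allpairsPdep; exists s, bs; split=> //.
    rewrite mem_filter mem_words_le sn' cay_words // /big_simple s3 cs ps /= andbT.
    exact/asboolP.
  by apply/slotsP; split=> //; [rewrite -sw | move=> u ubs; rewrite cbs ?pbs].
Qed.

Lemma Shat_ge3E i j :
  Shat_ge3 i j = (count (fun s => big_simple s && (nuniq s == j)) (words (i + j)))%:Z.
Proof.
rewrite /= -card_words; congr (Posz _); apply: eq_card => f; rewrite [LHS]inE [RHS]inE.
rewrite /big_simple size_word_of muE primitiveE -cayleyE.
case cf: (cayley f); rewrite ?andbF //=.
by rewrite (simpleE cf) -!andbA.
Qed.

Lemma nuniq_le s : (nuniq s <= size s)%N.
Proof. exact: count_size. Qed.

Lemma subst_y_Shat_ge3 n : subst_y Shat_ge3 P n =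
  \sum_(s <- words_le n | big_simple s) (P ^+ nuniq s * fps_X ^+ (size s - nuniq s)) n.
Proof.
have -> : subst_y Shat_ge3 P n = \sum_(k < n.+1) \sum_(j < (n - k).+1)
    (P ^+ j) (n - k)%N *~ Shat_ge3 k j by [].
rewrite -[RHS]big_filter; set L := filter _ _.
(* Simple words are sorted by their numbers [k] of repeated and [j] of unique positions. Neither
   [inord] falls back to its default, since [k + j] is the length, at most [n]. *)
rewrite [RHS](partition_big (fun s => inord (size s - nuniq s) : 'I_n.+1) xpredT) //.
apply: eq_bigr => k _.
rewrite [RHS](partition_big (fun s => inord (nuniq s) : 'I_(n - k).+1) xpredT) //.
apply: eq_bigr => j _; have kn := ltn_ord k; have jn := ltn_ord j.
rewrite Shat_ge3E -pmulrn -[_ *+ _]iter_addr_0 -big_const_seq.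
rewrite -[RHS]big_filter -[LHS]big_filter; set L1 := filter _ (words _); set L2 := filter _ L.
have L12 : perm_eq L1 L2.
  apply: uniq_perm; rewrite ?filter_uniq ?words_uniq ?words_le_uniq // => s.
  rewrite !mem_filter mem_words_le /= -!val_eqE /=.
  apply/idP/idP => [/andP[/andP[ss /eqP sj] sw]|].
    have sz : size s = (k + j)%N by move: sw; rewrite mem_words => /andP[/eqP].
    rewrite ss sz sw sj addnK !inord_val !eqxx /= andbT; lia.
  case/and3P => /andP[/eqP + /eqP +] ss /andP[sn sw].
  have nn := nuniq_le s; rewrite inordK => [sk|]; last by lia.
  rewrite inordK => [sj|]; last by lia.
  have <- : size s = (k + j)%N by rewrite -(subnK nn) sk sj.
  by rewrite ss sw sj eqxx.
rewrite -(perm_big _ L12) [LHS]big_seq [RHS]big_seq; apply: eq_bigr => s.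
rewrite mem_filter mem_words => /andP[/andP[_ /eqP ->] /andP[/eqP -> _]].
by rewrite addnK fps_mulX -ltnS kn.
Qed.

(** * The decomposition of [P] *)

Lemma pcay_words1 : perm_eq [seq u <- words 1 | pcay u] [:: [:: 0%N]].
Proof.
apply: uniq_perm; rewrite ?filter_uniq ?words_uniq // => u.
rewrite mem_filter mem_words inE.
apply/idP/eqP => [/andP[/and3P[_ cu _] /andP[/eqP su _]]|-> //].
exact: cay_size1.
Qed.

(** Any cut compares the first letter with the last one, and the two kinds do so in opposite
    directions. *)
Lemma cuts_exclusive w k l : cut true w k -> ~ cut false w l.
Proof.
move=> [/andP[k0 kw] c] [/andP[l0 lw] c'].
have := c 0%N (size w).-1; have := c' 0%N (size w).-1; rewrite k0 l0 /=; lia.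
Qed.

Lemma indec_size1 d w : size w = 1%N -> indec d w.
Proof. by move=> sw; apply/asboolP => k [] + _; rewrite sw; case: k. Qed.

Definition decs d : fps {poly int} := gf (fun u => pcay u && ~~ indec d u, nuniq).

(** With [I] the series of indecomposable words, [D = I P] and [P = I + D], so
    [D + D P = (I + D) P]. *)
Lemma decsE d : decs d * (1 + P) = P ^+ 2.
Proof.
have e : decs d = gf (fun u => pcay u && indec d u, nuniq) * P.
  by apply: fpsP => n; rewrite -cut_sum.
have e' : P = gf (fun u => pcay u && indec d u, nuniq) + decs d.
  by apply: fpsP => n; rewrite [in LHS]P_gf /= (bigID (indec d)).
by rewrite mulrDr mulr1 {1}e -mulrDl -e' expr2.
Qed.

Lemma unit_1P : 1 + P \is a GRing.unit.
Proof.
by change ((1 + P) 0%N \is a GRing.unit); rewrite fpsD P0 addr0 fps1 unitr1.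
Qed.

(** Four disjoint cases: the single letter, direct sums, skew sums, and longer words without cuts,
    which are the inflations of simple words. *)
Lemma P_split : P = fps_const 'X * fps_X + decs true + decs false + subst_y Shat_ge3 P.
Proof.
apply: fpsP => n; rewrite !fpsD fps_constM subst_y_Shat_ge3 -simple_sum.
rewrite [in LHS]P_gf /= (bigID (indec true)) /= [X in X + _](bigID (indec false)) /=.
set Dt := (X in _ + _ + X = _); set Df := (X in _ + X + _ = _).
rewrite -/Dt; have -> : \sum_(u <- words n | pcay u && ~~ indec false u) 'X^(nuniq u) = Df.
  apply: eq_bigl => w; case: (boolP (indec false w)) => [|idf]; rewrite ?andbF //= !andbT.
  case: (boolP (indec true w)) => [|idt]; rewrite ?andbT //.
  case/asboolPn/existsNP: idf => k /contrapT cf.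
  by case/asboolPn/existsNP: idt => l /contrapT ct; case: (cuts_exclusive ct cf).
suff -> : \sum_(u <- words n | pcay u && indec true u && indec false u) 'X^(nuniq u) =
    'X * (n == 1%N)%:R
    + \sum_(u <- words n | [&& pcay u, (1 < n)%N, indec true u & indec false u])
        'X^(nuniq u) :> {poly int} by ring.
case: (ltngtP n 1) => [n0|n1|->].
- rewrite mulr0 add0r [RHS]big_pred0 => [|u]; last by rewrite andbF.
  rewrite big_seq_cond big1 // => u /andP[+ /andP[/andP[/and3P[u0 _ _] _] _]].
  by rewrite mem_words => /andP[/eqP su _]; lia.
- by rewrite mulr0 add0r; apply: eq_bigl => u; rewrite -andbA.
rewrite mulr1 [X in _ = _ + X]big_pred0 => [|u]; last by rewrite andbF.
transitivity (\sum_(u <- words 1 | pcay u) 'X^(nuniq u) : {poly int}).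
  rewrite big_seq_cond [RHS]big_seq_cond; apply: eq_bigl => u.
  case: (boolP (u \in words 1)) => //; rewrite mem_words => /andP[/eqP su _].
  by rewrite !indec_size1 // !andbT.
by rewrite addr0 -big_filter (perm_big _ pcay_words1) big_seq1 expr1.
Qed.

Lemma first_identity :
  subst_y Shat_ge3 P = P - fps_const 'X * fps_X - 2 * P ^+ 2 / (1 + P).
Proof.
have decsV d : decs d = P ^+ 2 / (1 + P) by rewrite -(decsE d) mulrK ?unit_1P.
rewrite {2}P_split !decsV; ring.
Qed.

(** * Substitution for [t] *)

Lemma fps_horner_X (q : {poly fps int}) n :
  q.[fps_X] n = \sum_(k < n.+1) q`_k (n - k)%N.
Proof.
rewrite (horner_coef_wide _ (leq_maxl (size q) n.+1)) fps_sum.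
rewrite (big_ord_widen _ (fun k => q`_k (n - k)%N) (leq_maxr (size q) n.+1)) [RHS]big_mkcond.
by apply: eq_bigr => k _; rewrite fps_mulX ltnS.
Qed.

Section SubstT.
Variable V : fps int.

Definition eval_t (p : {poly int}) : fps int := (map_poly intr p).[V].

HB.instance Definition _ := GRing.RMorphism.copy eval_t (horner_eval V \o map_poly intr).

Lemma subst_tE F n : subst_t F V n = \sum_(k < n.+1) eval_t (F k) (n - k)%N.
Proof. by []. Qed.

(** On truncations the substitution is a polynomial evaluation, so its multiplicativity can be
    inherited from polynomials one coefficient at a time. *)
Lemma subst_t_trunc F N n : (n < N)%N ->
  subst_t F V n = (map_poly eval_t (fps_trunc N F)).[fps_X] n.
Proof.
move=> nN; rewrite fps_horner_X; apply: eq_bigr => k _.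
by rewrite coef_map coef_poly ifT // (leq_trans (ltn_ord k)).
Qed.

Lemma subst_t_local (F G : fps {poly int}) n : (forall m, (m <= n)%N -> F m = G m) ->
  subst_t F V n = subst_t G V n.
Proof. by move=> FG; apply: eq_bigr => k _; rewrite FG // -ltnS. Qed.

(** [V] is made a parameter so that the map in [F] alone can carry a ring morphism structure, which
    then transports the first identity, inverse included. *)
Definition subst_at F := subst_t F V.

Fact subst_at_zmod : zmod_morphism subst_at.
Proof.
move=> F G; apply: fpsP => n; rewrite fpsD fpsN /subst_at !subst_tE -sumrB.
apply: eq_bigr => k _.
by rewrite fpsD fpsN raddfB.
Qed.

Fact subst_at_monoid : monoid_morphism subst_at.
Proof.
split.
  apply: fpsP => n; rewrite /subst_at subst_tE big_ord_recl big1 => [|k _].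
    by rewrite rmorph1 subn0 addr0.
  by rewrite fps1 raddf0 fps0.
move=> F G; apply: fpsP => n; rewrite fpsM.
transitivity ((map_poly eval_t (fps_trunc n.+1 F * fps_trunc n.+1 G)).[fps_X] n).
  rewrite fps_horner_X; apply: eq_bigr => k _; rewrite coef_map.
  by rewrite -coef_fps_mul.
rewrite rmorphM hornerM fpsM; apply: eq_bigr => k _.
by rewrite -!subst_t_trunc // ltnS leq_subr.
Qed.

HB.instance Definition _ := GRing.isZmodMorphism.Build _ _ subst_at subst_at_zmod.
HB.instance Definition _ := GRing.isMonoidMorphism.Build _ _ subst_at subst_at_monoid.

Lemma subst_at_const p : subst_at (fps_const p) = eval_t p.
Proof.
apply: fpsP => n; rewrite /subst_at subst_tE big_ord_recl big1 => [|k _].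
  by rewrite subn0 addr0.
by rewrite [fps_const p _]/= raddf0 fps0.
Qed.

Lemma subst_at_X : subst_at fps_X = fps_X.
Proof.
apply: fpsP => n; rewrite /subst_at subst_tE.
case: n => [|n].
  by rewrite big_ord1 /= rmorph0 fps0.
rewrite !big_ord_recl big1 => [|k _]; last by rewrite rmorph0 fps0.
by rewrite /= rmorph0 fps0 rmorph1 fps1 addr0 add0r subSS subn0.
Qed.

End SubstT.

Lemma fpsMz (R : comNzRingType) (f : fps R) z n : (f *~ z) n = f n *~ z.
Proof.
have H m : (f *+ m) n = f n *+ m by elim: m => [|m IH]; rewrite ?fps0 // !mulrS fpsD IH.
by case: z => m; rewrite ?NegzE ?mulrNz ?fpsN -!pmulrn H.
Qed.

(** Powers of [Q] beyond the index vanish, so below [N] the infinite substitution agrees with a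
    finite sum, through which a ring morphism can pass. *)
Lemma subst_y_trunc (R : comNzRingType) (S : fps (fps int)) (Q : fps R) n N :
  Q 0%N = 0 -> (n < N)%N ->
  subst_y S Q n = (\sum_(k < N) \sum_(j < N) (Q ^+ j * fps_X ^+ k) *~ S k j) n.
Proof.
move=> Q0 nN; rewrite fps_sum.
rewrite -[LHS]/(\sum_(k < n.+1) \sum_(j < (n - k).+1) (Q ^+ j) (n - k)%N *~ S k j).
rewrite (big_ord_widen _ (fun k => \sum_(j < (n - k).+1) (Q ^+ j) (n - k)%N *~ S k j) nN).
rewrite big_mkcond /=; apply: eq_bigr => k _; rewrite fps_sum ltnS.
under [RHS]eq_bigr do rewrite fpsMz fps_mulX.
case: leqP => kn; last by rewrite big1 // => j _; rewrite mul0rz.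
have le : ((n - k).+1 <= N)%N by lia.
rewrite (big_ord_widen _ (fun j => (Q ^+ j) (n - k)%N *~ S k j) le) big_mkcond /=.
by apply: eq_bigr => j _; case: ltnP => // jn; rewrite fpsX_lt ?mul0rz.
Qed.

(** A ring morphism need not respect infinite sums, but a coefficient of [subst_t F V] uses only the
    coefficients of [F] up to its index, so the finite sum can be substituted instead. *)
Lemma subst_at_subst_y V (S : fps (fps int)) (Q : fps {poly int}) : Q 0%N = 0 ->
  subst_at V (subst_y S Q) = subst_y S (subst_at V Q).
Proof.
move=> Q0; apply: fpsP => n.
have Q0' : subst_at V Q 0%N = 0.
  by rewrite /subst_at subst_tE big_ord1 Q0 raddf0 fps0.
rewrite (subst_y_trunc _ Q0' (ltnSn n)).
pose T := \sum_(k < n.+1) \sum_(j < n.+1) (Q ^+ j * fps_X ^+ k) *~ S k j.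
transitivity (subst_at V T n).
  by apply: subst_t_local => m mn; rewrite (subst_y_trunc _ Q0 (_ : m < n.+1)%N).
congr (fps_coef _ n); rewrite /T raddf_sum; apply: eq_bigr => k _.
rewrite raddf_sum; apply: eq_bigr => j _.
by rewrite raddfMz /= rmorphM !rmorphXn /= subst_at_X.
Qed.

Lemma subst_y_X S n : subst_y S (fps_X : fps int) n = \sum_(k < n.+1) S k (n - k)%N.
Proof.
apply: eq_bigr => k _ /=; rewrite big_ord_recr /= big1 ?add0r => [|j _].
  by rewrite -[fps_X ^+ _]mul1r fps_mulX leqnn subnn fps1 eqxx intz.
by rewrite -[fps_X ^+ _]mul1r fps_mulX ltnW // fps1 subn_eq0 leqNgt ltn_ord mul0rz.
Qed.

(** * The univariate series *)

Definition psimple s : bool := [&& 0 < size s, cay s, prim s & `[< simplew s >]]%N.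

Lemma ShatE n : Shat n = (count psimple (words n))%:Z.
Proof.
rewrite /= -card_words; congr (Posz _); apply: eq_card => f; rewrite [LHS]inE [RHS]inE.
rewrite /psimple size_word_of primitiveE -cayleyE.
case cf: (cayley f); rewrite ?andbF //=.
by rewrite (simpleE cf).
Qed.

(** Among at most two positions, a set that misses one has at most one element. *)
Lemma psimple_le2 s : (size s <= 2)%N -> psimple s = [&& 0 < size s, cay s & prim s]%N.
Proof.
move=> s2; rewrite /psimple; have -> : `[< simplew s >]; last by rewrite andbT.
apply/asboolP => A _ [k ks nA] i j il jl Ai Aj.
have ik : i <> k by move=> e; rewrite -e Ai in nA.
have jk : j <> k by move=> e; rewrite -e Aj in nA.
by lia.
Qed.

Lemma psimple_words1 : count psimple (words 1) = 1%N.
Proof.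
rewrite -size_filter; have -> : [seq s <- words 1 | psimple s] = [seq s <- words 1 | pcay s].
  apply: eq_in_filter => s; rewrite mem_words => /andP[/eqP ss _].
  by apply: psimple_le2; rewrite ss.
by rewrite (perm_size pcay_words1).
Qed.

Lemma psimple_words2 : count psimple (words 2) = 2.
Proof.
rewrite -size_filter (@perm_size _ _ [:: duo true; duo false]) //.
apply: uniq_perm; rewrite ?filter_uniq ?words_uniq // => s.
rewrite mem_filter mem_words !inE; apply/andP/orP => [[+ /andP[/eqP ss sl]]|].
  rewrite psimple_le2 ?ss // => /and3P[_ _ ps].
  case: s ss sl ps => [|a [|b []]] //= _ /and3P[a2 b2 _] /andP[+ _].
  by case: a a2 => [|[]] //; case: b b2 => [|[]] //= _ _ _; [left | right].
by case=> /eqP->; split=> //; rewrite psimple_le2.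
Qed.

Lemma sum_Shat_ge3 n :
  \sum_(k < n.+1) Shat_ge3 k (n - k)%N = (count big_simple (words n))%:Z.
Proof.
have cE (p : pred (seq nat)) L : (count p L)%:Z = \sum_(s <- L | p s) 1.
  by rewrite big_const_seq iter_addr_0 natz.
under eq_bigr => k _.
  rewrite Shat_ge3E subnKC -1?ltnS // cE; over.
rewrite cE [RHS](partition_big (fun s => inord (n - nuniq s) : 'I_n.+1) xpredT) //.
apply: eq_bigr => k _; rewrite big_seq_cond [RHS]big_seq_cond; apply: eq_bigl => s.
case: (boolP (s \in words n)) => //; rewrite mem_words => /andP[/eqP sn _].
have ns := nuniq_le s; have kn := ltn_ord k; rewrite sn in ns.
congr (_ && _); rewrite -val_eqE /= inordK; last by lia.
by apply/eqP/eqP; lia.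
Qed.

(** For [y := x] the two exponents add up to the length. The extra terms count the word of length
    one and the words 12 and 21. *)
Lemma Shat_split :
  Shat = subst_y Shat_ge3 fps_X + fps_X + 2 * fps_X ^+ 2.
Proof.
apply: fpsP => n; rewrite !fpsD subst_y_X sum_Shat_ge3 ShatE.
have -> : (2 * fps_X ^+ 2 : fps int) n = 2 * (n == 2)%:R.
  rewrite fps_mulX -[X in (X : fps int) _]/(1 + 1 : fps int) fpsD !fps1 subn_eq0.
  by case: (ltngtP n 2); rewrite ?mulr0 ?mulr1 ?addr0.
have -> : (fps_X : fps int) n = (n == 1%N)%:R by [].
have small : (n <= 2)%N -> count big_simple (words n) = 0%N.
  move=> n2; rewrite -[RHS](count_pred0 (words n)); apply: eq_in_count => s.
  by rewrite mem_words => /andP[/eqP ss _]; rewrite /big_simple ss ltnNge n2.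
case: n small => [|[|[|n]]] small.
- rewrite small // -[RHS]/(Posz 0); congr (Posz _).
  transitivity (count big_simple (words 0)); last exact: small.
  by apply: eq_in_count => s; rewrite mem_words /psimple /big_simple => /andP[/eqP->].
- by rewrite small // psimple_words1.
- by rewrite small // psimple_words2.
rewrite -[n.+3 == 1%N]/false -[n.+3 == 2]/false mulr0 !addr0.
congr (Posz _); apply: eq_in_count => s.
by rewrite mem_words => /andP[/eqP ss _]; rewrite /psimple /big_simple ss.
Qed.

(** * The series [W] *)

(** Congruence modulo $X^N$, the measure of closeness for the fixed point argument. *)
Definition agree (R : Type) N (f g : fps R) : Prop := forall i, (i < N)%N -> f i = g i.

Lemma agreeD (R : comNzRingType) N (f f' g g' : fps R) :
  agree N f f' -> agree N g g' -> agree N (f + g) (f' + g').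
Proof. by move=> ff gg i iN; rewrite !fpsD ff ?gg. Qed.

Lemma agreeM (R : comNzRingType) N (f f' g g' : fps R) :
  agree N f f' -> agree N g g' -> agree N (f * g) (f' * g').
Proof.
move=> ff gg i iN; rewrite !fpsM; apply: eq_bigr => k _.
by rewrite ff ?gg //; have := ltn_ord k; lia.
Qed.

Lemma agree_eval_t N V V' p : agree N V V' -> agree N (eval_t V p) (eval_t V' p).
Proof.
move=> VV; elim/poly_ind: p => [|p c IH]; first by move=> i _; rewrite !raddf0.
rewrite !rmorphD !rmorphM.
have eX U : eval_t U 'X = U by rewrite /eval_t map_polyX hornerX.
have eC U : eval_t U c%:P = c%:~R by rewrite /eval_t map_polyC hornerC.
by rewrite /= !eX !eC; apply: agreeD => //; apply: agreeM.
Qed.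

Lemma contraction_fix (R : comNzRingType) (T : fps R -> fps R) :
  (forall N f g, agree N f g -> agree N.+1 (T f) (T g)) ->
  exists W, T W = W /\ forall V, T V = V -> W = V.
Proof.
move=> hT; pose I N := iter N T 0.
have step N d : agree N (I N) (I (N + d)%N).
  by elim: N => [|N IH] //; apply: hT.
(* Each iteration fixes one more coefficient, so the coefficient [n] is final from the iterate
   [n.+1] on. *)
pose W : fps R := Fps (fun n => I n.+1 n).
have WI N : agree N W (I N).
  by move=> i iN; rewrite -(subnKC iN) -step.
have TW : T W = W by apply: fpsP => n; rewrite (hT n _ _ (WI n)).
exists W; split=> // V TV; apply: fpsP => n.
have WV N : agree N W V.
  elim: N => [|N IH] //; rewrite -TW -TV; exact: hT.
exact: (WV n.+1).
Qed.

Lemma P1 : P 1%N = 'X.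
Proof.
rewrite P_gf [LHS]/= -big_filter (perm_big _ pcay_words1) big_seq1.
by rewrite expr1.
Qed.

(** As the linear coefficient of [P] is [t], the coefficient [V n] appears by itself, and the sum
    involves only coefficients of [V] below [n]. This is what makes the equation a contraction. *)
Lemma subst_t_PE V n : subst_t P V n.+1 =
  V n + \sum_(k < n) eval_t V (P k.+2) (n - k.+1)%N.
Proof.
rewrite subst_tE !big_ord_recl P0 raddf0 fps0 add0r P1.
rewrite /eval_t map_polyX hornerX subSS subn0; congr (_ + _).
Qed.

Lemma subst_t_P_root : exists W, unique (fun V => subst_t P V = fps_X) W.
Proof.
(* The equation at index [n.+1] solved for [V n]; the coefficient of [fps_X] there is 1 exactly when
   [n] is 0. *)
pose T (V : fps int) : fps int := Fps (fun n =>
  (n == 0%N)%:R - \sum_(k < n) eval_t V (P k.+2) (n - k.+1)%N).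
have TE V : T V = V <-> subst_t P V = fps_X.
  split=> [TV|h]; apply: fpsP => n.
    case: n => [|n]; first by rewrite subst_tE big_ord1 P0 raddf0 fps0.
    by rewrite subst_t_PE -{1}TV /= subrK.
  have := congr1 (fun f : fps int => f n.+1) h; rewrite subst_t_PE => e.
  by apply/eqP; rewrite /= subr_eq e.
have [|W [TW W_uniq]] := @contraction_fix _ T.
  move=> N f g fg i iN /=; congr (_ - _); apply: eq_bigr => k _.
  by apply: (agree_eval_t _ fg); have := ltn_ord k; lia.
by exists W; split=> [|V /TE]; [apply/TE | apply: W_uniq].
Qed.

Theorem theorem5p3 :
  subst_y Shat_ge3 P = P - fps_const 'X * fps_X - 2 * P ^+ 2 / (1 + P)
  /\ exists W : fps int,
       unique (fun V : fps int => subst_t P V = fps_X) W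
       /\ Shat = 2 * fps_X + 2 * fps_X ^+ 3 / (1 + fps_X) - fps_X * W.
Proof.
split; first exact: first_identity.
have [W W_root] := subst_t_P_root; exists W; split=> //.
have PW : subst_at W P = fps_X := W_root.1.
have u1X : 1 + fps_X \is a @GRing.unit (fps int).
  by change (((1 + fps_X : fps int) 0%N) \is a GRing.unit).
have := congr1 (subst_at W) first_identity.
rewrite subst_at_subst_y ?P0 // !(rmorphB, rmorphM, rmorphXn) /=.
rewrite rmorphV ?unit_1P // !rmorphD !rmorph1 /= PW subst_at_X subst_at_const.
rewrite /eval_t map_polyX hornerX => eS.
(* Here [X - X W - 2 X^2 / (1 + X)] is increased by [X + 2 X^2], and [2 X^2 - 2 X^2 / (1 + X)]
   equals [2 X^3 / (1 + X)]. *)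
rewrite Shat_split eS.
apply: (mulIr u1X); rewrite !(mulrDl, mulNr) !divrK //; ring.
Qed.
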